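(* Let $N\geq 1$, let $m_I,m_E\geq 0$ be integers with $m=m_I+m_E\geq 1$, and let $q_i(x)=x^\top A_i x+2b_i^\top x+c_i$ ($i=0,\dots,m$) be quadratic functions on $\mathbb{R}^N$ with $A_i\in\mathbb{S}^N$, $b_i\in\mathbb{R}^N$, $c_i\in\mathbb{R}$. Suppose that the set $\{x\in\mathbb{R}^N : q_i(x)\leq 0 \text{ for } i=1,\dots,m_I,\ q_i(x)=0 \text{ for } i=m_I+1,\dots,m\}$ is nonempty, that there exists $\gamma^*\in\mathbb{R}^m$ with $\gamma^*_i\geq 0$ for all $i=1,\dots,m_I$ and $A_0+\sum_{i=1}^m\gamma_i^*A_i\succ 0$, and that the set $\Gamma$ defined in the context is polyhedral. Write $\Gamma=\Gamma_e+\operatorname{cone}(\Gamma_r)$ with $\Gamma_e,\Gamma_r\subseteq\mathbb{R}^m$ polytopes (such a decomposition exists by the Minkowski–Weyl theorem). Then $$\mathcal{D}_{\mathrm{SDP}}=\left\{(x,t)\in\mathbb{R}^{N+1} : \begin{array}{l} q(\gamma_e,x)\leq 2t\ \ \forall\gamma_e\in\operatorname{extr}(\Gamma_e)\\ \breve q(\gamma_f,x)\leq 0\ \ \forall\gamma_f\in\operatorname{extr}(\Gamma_r)\end{array}\right\}.$$ That is, $\mathcal{D}_{\mathrm{SDP}}$ is defined by finitely many convex quadratic inequalities, and in particular $\mathcal{D}_{\mathrm{SDP}}$ is second-order cone (SOC) representable. Moreover, if in addition either (i) every semidefinite face $\mathcal{F}$ of $\Gamma$ satisfies $\dim(\mathcal{V}(\mathcal{F}))\geq\operatorname{aff\,dim}(\{b(\gamma):\gamma\in\mathcal{F}\})+1$,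 or (ii) every semidefinite face $\mathcal{F}$ of $\Gamma$ satisfies $k\geq\operatorname{aff\,dim}(\{b(\gamma):\gamma\in\mathcal{F}\})+1$, where $k$ is the quadratic eigenvalue multiplicity, then $\operatorname{conv}(\mathcal{D})$ is SOC representable.
   Context: $\mathbb{S}^N$ denotes the real symmetric $N\times N$ matrices; $\operatorname{conv}$, $\operatorname{cone}$, $\operatorname{extr}$ denote convex hull, conic hull, and set of extreme points; $\operatorname{aff\,dim}$ is the affine dimension; $\otimes$ is the Kronecker product. Epigraph of the QCQP: $\mathcal{D}=\{(x,t)\in\mathbb{R}^N\times\mathbb{R} : q_0(x)\leq 2t,\ q_i(x)\leq 0\ (1\leq i\leq m_I),\ q_i(x)=0\ (m_I+1\leq i\leq m)\}$. Projected epigraph of the SDP relaxation: let $Q_i=\begin{pmatrix}c_i & b_i^\top\\ b_i & A_i\end{pmatrix}\in\mathbb{S}^{N+1}$. Then $\mathcal{D}_{\mathrm{SDP}}$ is the set of $(x,t)\in\mathbb{R}^{N+1}$ for which there exists $X\in\mathbb{S}^N$ such that $Y=\begin{pmatrix}1&x^\top\\ x&X\end{pmatrix}$ satisfies $Y\succeq 0$, $\langle Q_0,Y\rangle\leq 2t$, $\langle Q_i,Y\rangle\leq 0$ for $1\leq i\leq m_I$, and $\langle Q_i,Y\rangle=0$ for $m_I+1\leq i\leq m$. For $\gamma\in\mathbb{R}^m$: $A(\gamma)=A_0+\sum_{i=1}^m\gamma_iA_i$, $b(\gamma)=b_0+\sum_{i=1}^m\gamma_ib_i$, $q(\gamma,x)=q_0(x)+\sum_{i=1}^m\gamma_iq_i(x)$,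 and $\breve q(\gamma,x)=\sum_{i=1}^m\gamma_iq_i(x)$. The dual object is $\Gamma=\{\gamma\in\mathbb{R}^m : A(\gamma)\succeq 0,\ \gamma_i\geq 0\ (1\leq i\leq m_I)\}$. A face $\mathcal{F}$ of $\Gamma$ is definite if there exists $\gamma\in\mathcal{F}$ with $A(\gamma)\succ 0$; otherwise it is semidefinite, and $\mathcal{V}(\mathcal{F})=\{v\in\mathbb{R}^N : A(\gamma)v=0\ \forall\gamma\in\mathcal{F}\}$. The quadratic eigenvalue multiplicity is the largest integer $k$ (necessarily a divisor of $N$; write $N=nk$) such that for every $i\in\{0,1,\dots,m\}$ there exists $\mathcal{A}_i\in\mathbb{S}^n$ with $A_i=I_k\otimes\mathcal{A}_i$. *)

(* Defs.v *)
From HB Require Import structures.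
From mathcomp Require Import all_boot all_order all_algebra.
From mathcomp Require Import mxtens.
From mathcomp Require Import all_classical all_reals.
From mathcomp Require Import convex.

Set Implicit Arguments.
Unset Strict Implicit.
Unset Printing Implicit Defensive.

Import Order.TTheory GRing.Theory Num.Theory.

Local Open Scope classical_set_scope.
Local Open Scope ring_scope.

Section ConvexGeometry.
Context {R : realType}.

Definition conv_hull {V : lmodType R} (S : set V) : set V :=
  smallest (@convex_set R V) S.

Definition convex_cone {V : lmodType R} (C : set V) : Prop :=
  [/\ C 0,
      (forall x y, C x -> C y -> C (x + y))
    & (forall (a : R) x, 0 <= a -> C x -> C (a *: x))].

(* In particular the conic hull of set0 is [set 0]. *)
Definition conic_hull {V : lmodType R} (S : set V) : set V := smallest convex_cone S.

Definition extr {V : lmodType R} (S : set V) : set V :=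
  [set x | S x /\ forall y z (l : R), S y -> S z -> 0 < l -> l < 1 ->
             x = l *: y + (1 - l) *: z -> y = x /\ z = x].

(* The empty set counts as a face; its affine dimension below is -1. *)
Definition is_face {V : lmodType R} (C F : set V) : Prop :=
  [/\ F `<=` C,
      @convex_set R V F
    & forall x y (l : R), C x -> C y -> 0 < l -> l < 1 ->
        F (l *: x + (1 - l) *: y) -> F x /\ F y].

Definition polyhedral {n} (S : set 'cV[R]_n) : Prop :=
  exists (p : nat) (G : 'M[R]_(p, n)) (h : 'cV[R]_p),
    S = [set x | forall i, (G *m x) i 0 <= h i 0].

Definition polytope {V : lmodType R} (S : set V) : Prop :=
  exists2 F : set V, finite_set F & S = conv_hull F.

(* Dimension of the linear span of S, as the size of a largest linearly
   independent family of elements of S. *)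
Definition lin_dim {V : vectType R} (S : set V) : nat :=
  \max_(d < (\dim {:V}).+1 |
        `[< exists2 X : d.-tuple V, free X & forall x, x \in X -> S x >]) d.

Definition aff_dim {V : vectType R} (S : set V) : int :=
  if `[< S !=set0 >] then (lin_dim [set x - y | x in S & y in S])%:Z else -1.

Definition psd {n} (M : 'M[R]_n) : Prop :=
  M^T = M /\ forall v : 'cV[R]_n, 0 <= (v^T *m M *m v) 0 0.

Definition pd {n} (M : 'M[R]_n) : Prop :=
  M^T = M /\ forall v : 'cV[R]_n, v != 0 -> 0 < (v^T *m M *m v) 0 0.

Definition frob {n} (M Y : 'M[R]_n) : R := \tr (M^T *m Y).

Definition norm2 {n} (v : 'cV[R]_n) : R := Num.sqrt (\sum_i v i 0 ^+ 2).

(* The constraint ||L w + a||_2 <= l w + b on w : W. *)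
Record soc_constraint (W : lmodType R) := SocConstraint {
  soc_size : nat;
  soc_L : {linear W -> 'cV[R]_soc_size};
  soc_a : 'cV[R]_soc_size;
  soc_l : {linear W -> R^o};
  soc_b : R }.

Definition soc_sat {W : lmodType R} (c : soc_constraint W) (w : W) : Prop :=
  norm2 (soc_L c w + soc_a c) <= soc_l c w + soc_b c.

(* Projection of the solution set of finitely many second-order cone
   constraints in (x, u), with u a vector of auxiliary variables. *)
Definition soc_representable {V : lmodType R} (S : set V) : Prop :=
  exists (r p : nat) (c : 'I_p -> soc_constraint (V * 'cV[R]_r)%type),
    S = [set x | exists u : 'cV[R]_r, forall j, soc_sat (c j) (x, u)].

End ConvexGeometry.

Record quadratic (R : realType) (N : nat) := Quadratic {
  qA : 'M[R]_N;
  qb : 'cV[R]_N;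
  qc : R;
  qA_sym : qA^T = qA }.

(* Constraints indexed by lshift mE i are inequalities, those indexed by
   rshift mI j are equations. *)
Record qcqp (R : realType) (N mI mE : nat) := QCQP {
  obj : quadratic R N;
  cstr : 'I_(mI + mE) -> quadratic R N }.

Section QCQP.
Context {R : realType} {N mI mE : nat}.

Definition qeval (q : quadratic R N) (x : 'cV[R]_N) : R :=
  (x^T *m qA q *m x) 0 0 + 2 * ((qb q)^T *m x) 0 0 + qc q.

Definition qmx (q : quadratic R N) : 'M[R]_(1 + N) :=
  block_mx (qc q)%:M (qb q)^T (qb q) (qA q).

Variable P : qcqp R N mI mE.

Definition feasible : set 'cV[R]_N :=
  [set x | (forall i : 'I_mI, qeval (cstr P (lshift mE i)) x <= 0) /\
           (forall j : 'I_mE, qeval (cstr P (rshift mI j)) x = 0)].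

Definition epi : set ('cV[R]_N * R^o)%type :=
  [set z | qeval (obj P) z.1 <= 2 * z.2 /\ feasible z.1].

Definition epi_sdp : set ('cV[R]_N * R^o)%type :=
  [set z | exists2 X : 'M[R]_N, X^T = X &
     let Y : 'M[R]_(1 + N) := block_mx 1%:M (z.1)^T z.1 X in
     [/\ psd Y,
         frob (qmx (obj P)) Y <= 2 * z.2,
         (forall i : 'I_mI, frob (qmx (cstr P (lshift mE i))) Y <= 0)
       & (forall j : 'I_mE, frob (qmx (cstr P (rshift mI j))) Y = 0)]].

Definition Aagg (g : 'cV[R]_(mI + mE)) : 'M[R]_N :=
  qA (obj P) + \sum_i g i 0 *: qA (cstr P i).

Definition bagg (g : 'cV[R]_(mI + mE)) : 'cV[R]_N :=
  qb (obj P) + \sum_i g i 0 *: qb (cstr P i).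

Definition qbreve (g : 'cV[R]_(mI + mE)) (x : 'cV[R]_N) : R :=
  \sum_i g i 0 * qeval (cstr P i) x.

Definition qagg (g : 'cV[R]_(mI + mE)) (x : 'cV[R]_N) : R :=
  qeval (obj P) x + \sum_i g i 0 * qeval (cstr P i) x.

Definition Gamma : set 'cV[R]_(mI + mE) :=
  [set g | psd (Aagg g) /\ forall i : 'I_mI, 0 <= g (lshift mE i) 0].

Definition definite (F : set 'cV[R]_(mI + mE)) : Prop :=
  exists2 g, F g & pd (Aagg g).

Definition semidefinite_face (F : set 'cV[R]_(mI + mE)) : Prop :=
  is_face Gamma F /\ ~ definite F.

Definition VF (F : set 'cV[R]_(mI + mE)) : set 'cV[R]_N :=
  [set v | forall g, F g -> Aagg g *m v = 0].

Definition kron_factor (k : nat) (M : 'M[R]_N) : Prop :=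
  exists (n : nat) (e : (k * n)%N = N) (B : 'M[R]_n),
    B^T = B /\ M = castmx (e, e) ((1%:M : 'M[R]_k) *t B).

(* The largest k is taken over k <= N, as N = n * k with 0 < N. *)
Definition qem : nat :=
  \max_(k < N.+1 | `[< kron_factor k (qA (obj P)) /\
                       forall i, kron_factor k (qA (cstr P i)) >]) k.

Definition MW_decomposition (Ge Gr : set 'cV[R]_(mI + mE)) : Prop :=
  [/\ polytope Ge, polytope Gr & Gamma = [set e + f | e in Ge & f in conic_hull Gr]].

End QCQP.

(* Main.v *)
(** The bridge between all the sets involved is the aggregated description
    { (x, t) | q(g, x) <= 2 t for all g in Gamma }.

    It contains the projected SDP relaxation because tr (A(g) (X - x x^T)) >= 0. Conversely the
    missing W = X - x x^T is obtained by conic duality: the cone of values of W = B B^T and squared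
    slacks is the image of a quadratic map vanishing only at 0 (this is where the definite
    multiplier enters), hence closed. A Minkowski-Weyl decomposition of Gamma turns the aggregated
    description into finitely many convex quadratic inequalities, each a second-order cone constraint.

    For the convex hull, take an aggregated point with 2 t = sup q(g, x) and let F be the face of
    Gamma attaining the supremum. If F is definite, complementary slackness forces X = x x^T, so the
    point lies in the epigraph. Otherwise (i) or (ii) gives v <> 0 in V(F) on which b(g) is constant
    over F; all tight constraints stay tight along (v, s), and since some A(g) is definite another
    constraint becomes tight in both directions. The point is a convex combination of two points
    with more tight constraints, and there are finitely many constraints. *)

From HB Require Import structures.
Require Import Defs.
From mathcomp Require Import all_boot all_order all_algebra.
From mathcomp Require Import mxtens ring lra.
From mathcomp Require Import all_classical all_reals all_analysis convex.

Set Implicit Arguments.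
Unset Strict Implicit.
Unset Printing Implicit Defensive.

Import Order.TTheory GRing.Theory Num.Theory.
Import numFieldNormedType.Exports.

Local Open Scope classical_set_scope.
Local Open Scope ring_scope.

(** * Convex hulls and polytopes *)

Section ConvexHull.
Context {R : realType} {V : lmodType R}.
Implicit Types (S C : set V) (x y z : V) (s : seq V).

Lemma convex_setP S : convex_set S <->
  forall x y (l : R), S x -> S y -> 0 <= l -> l <= 1 -> S (l *: x + (1 - l) *: y).
Proof.
split=> [cS x y l Sx Sy l0 l1|cS x y l /set_mem Sx /set_mem Sy].
  have /set_mem := cS x y (Itv01 l0 l1) (mem_set Sx) (mem_set Sy).
  by [].
by apply/mem_set/cS.
Qed.

Lemma conv_hull_convex S : convex_set (conv_hull S).
Proof.
apply/convex_setP => x y l Sx Sy l0 l1 C [cC SC].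
by move/convex_setP: (cC); apply=> //; [apply: Sx|apply: Sy].
Qed.

Lemma sub_conv_hull S : S `<=` conv_hull S.
Proof. exact: sub_gen_smallest. Qed.

Lemma conv_hull_sub S C : convex_set C -> S `<=` C -> conv_hull S `<=` C.
Proof. exact: smallest_sub. Qed.

Lemma conv_hull_mono S C : S `<=` C -> conv_hull S `<=` conv_hull C.
Proof.
move=> SC; apply: conv_hull_sub; first exact: conv_hull_convex.
exact: subset_trans SC (@sub_conv_hull C).
Qed.

Lemma conic_hull_cone S : convex_cone (conic_hull S).
Proof.
split=> [C [[]]//|x y Sx Sy C CS|a x a0 Sx C CS].
  by have [[_ + _] _] := CS; apply; [apply: Sx|apply: Sy].
by have [[_ _ +] _] := CS; apply => //; apply: Sx.
Qed.

Lemma sub_conic_hull S : S `<=` conic_hull S.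
Proof. exact: sub_gen_smallest. Qed.

Lemma conic_hull_sub S C : convex_cone C -> S `<=` C -> conic_hull S `<=` C.
Proof. exact: smallest_sub. Qed.

Lemma convex_cone_convex C : convex_cone C -> convex_set C.
Proof.
case=> _ Cadd Cscale; apply/convex_setP => x y l Cx Cy l0 l1.
by apply: Cadd; apply: Cscale => //; rewrite subr_ge0.
Qed.

Lemma convex_cone_sum C (I : finType) (Q : pred I) (F : I -> V) :
  convex_cone C -> (forall i, Q i -> C (F i)) -> C (\sum_(i | Q i) F i).
Proof.
by case=> C0 Cadd _ CF; exact: (big_ind C).
Qed.

(** Convexity for weights that need not sum to one. If [a + b = 0], both weights vanish and any
    point of [S] serves. *)
Lemma convex_combine S (a b : R) x y : convex_set S -> S x -> S y -> 0 <= a -> 0 <= b ->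
  exists2 w, S w & a *: x + b *: y = (a + b) *: w.
Proof.
move=> /convex_setP cS Sx Sy a0 b0.
have [ab0|abN0] := eqVneq (a + b) 0.
  exists x => //; have [-> ->] : a = 0 /\ b = 0 by split; lra.
  by rewrite addr0 !scale0r addr0.
have ab_gt0 : 0 < a + b by rewrite lt_neqAle eq_sym abN0 addr_ge0.
exists ((a / (a + b)) *: x + (1 - a / (a + b)) *: y).
  by apply: cS => //; [rewrite divr_ge0// ltW|rewrite ler_pdivrMr// mul1r lerDl].
rewrite scalerDr !scalerA.
by congr (_ *: _ + _ *: _); field.
Qed.

(** Membership is asked only where the weight is nonzero, so that a family such as [(t i)^-1 *: g i]
    may contain meaningless terms with [t i = 0]. *)
Lemma convex_combine_sum S (I : finType) (c : I -> R) (v : I -> V) :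
  convex_set S -> S !=set0 -> (forall i, 0 <= c i) -> (forall i, c i != 0 -> S (v i)) ->
  exists2 w, S w & \sum_i c i *: v i = (\sum_i c i) *: w.
Proof.
move=> cS [x0 Sx0] c0 Sv.
(* The induction also carries the sign of the partial sum of weights, which [convex_combine]
   requires. *)
suff [_ //] : 0 <= \sum_i c i /\
    exists2 w, S w & \sum_i c i *: v i = (\sum_i c i) *: w.
apply: (big_rec2 (fun (p : V) (a : R) => 0 <= a /\ exists2 w, S w & p = a *: w)).
  by split=> //; exists x0; rewrite ?scale0r.
move=> i p a _ [a0 [w Sw ->]]; split; first exact: addr_ge0.
have [ci0|ciN0] := eqVneq (c i) 0.
  by exists w => //; rewrite ci0 scale0r !add0r.
have [u Su ->] := convex_combine cS (Sv _ ciN0) Sw (c0 i) a0.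
by exists u.
Qed.

(** The union of the segments from [a] to the hull of [s] is convex: in a combination the weights of
    [a] add up and the two hull points merge into one. *)
Lemma conv_hull_cons a s x : [set` s] !=set0 -> conv_hull [set` a :: s] x ->
  exists (l : R) (y : V),
    [/\ 0 <= l, l <= 1, conv_hull [set` s] y & x = l *: a + (1 - l) *: y].
Proof.
case=> y0 sy0; have hy0 := sub_conv_hull sy0.
pose T := [set x | exists (l : R) (y : V),
    [/\ 0 <= l, l <= 1, conv_hull [set` s] y & x = l *: a + (1 - l) *: y]].
apply: (@conv_hull_sub _ T).
  apply/convex_setP => _ _ t [l [y [l0 l1 hy ->]]] [l' [y' [l0' l1' hy' ->]]] t0 t1.
  have t1' : 0 <= 1 - t by rewrite subr_ge0.
  have k0 : 0 <= t * (1 - l) by rewrite mulr_ge0// subr_ge0.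
  have k0' : 0 <= (1 - t) * (1 - l') by rewrite mulr_ge0// subr_ge0.
  have [w hw e] := convex_combine (@conv_hull_convex _) hy hy' k0 k0'.
  exists (t * l + (1 - t) * l'), w; split => //.
  - by rewrite addr_ge0// mulr_ge0.
  - have := ler_piMr t0 l1; have := ler_piMr t1' l1'; lra.
  - rewrite !scalerDr !scalerA addrACA e -scalerDl; congr (_ + _ *: _); ring.
move=> x' /=; rewrite inE => /orP[/eqP->|x's].
  by exists 1, y0; split=> //; rewrite subrr scale1r scale0r addr0.
exists 0, x'; split=> //; first exact: sub_conv_hull.
by rewrite subr0 scale1r scale0r add0r.
Qed.

Lemma conv_hull1 a : conv_hull ([set a] : set V) = [set a].
Proof.
apply: smallest_id; apply/convex_setP => x y l -> -> _ _ /=.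
by rewrite -scalerDl addrC subrK scale1r.
Qed.

(** Deleting an extreme point from the hull leaves a convex set. If that point were outside [S], the
    remaining set would still contain [S], hence the whole hull. *)
Lemma extr_conv_hull_sub S : extr (conv_hull S) `<=` S.
Proof.
move=> x [hx ex]; apply: contrapT => Sx.
suff /(_ x hx)[] : conv_hull S `<=` [set y | conv_hull S y /\ y <> x] by [].
apply: conv_hull_sub; last first.
  by move=> y Sy; split; [exact: sub_conv_hull|move=> yx; apply: Sx; rewrite -yx].
apply/convex_setP => y z l [hy yx] [hz zx] l0 l1; split.
  by move/convex_setP: (@conv_hull_convex S); apply.
move=> e; have [l00|lN0] := eqVneq l 0.
  by apply: zx; rewrite -e l00 scale0r add0r subr0 scale1r.
have [l11|lN1] := eqVneq l 1.
  by apply: yx; rewrite -e l11 subrr scale0r addr0 scale1r.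
have [] := ex y z l hy hz _ _ (esym e); last by [].
  by rewrite lt_neqAle eq_sym lN0.
by rewrite lt_neqAle lN1.
Qed.

(** The finite case of Krein-Milman: a generator that is not extreme lies in the hull of the others,
    so it can be discarded, and the list shrinks until only extreme points remain. *)
Lemma conv_hull_seq_extr s : exists2 s' : seq V, conv_hull [set` s'] = conv_hull [set` s] &
  [set` s'] `<=` extr (conv_hull [set` s]).
Proof.
have [n] := ubnP (size s); elim: n s => // n IHn s sn.
have [|/existsNP[a /not_implyP[/= as_ aNext]]] :=
  pselect ([set` s] `<=` extr (conv_hull [set` s])); first by exists s.
pose s1 := [seq x <- s | predC1 a x].
have ss1 : [set` s] `<=` [set` a :: s1].
  by move=> x /= xs; rewrite inE mem_filter /= xs andbT; case: eqP.
have s1s : [set` s1] `<=` [set` s] by move=> x /=; rewrite mem_filter => /andP[].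
have hs1 : conv_hull [set` s1] `<=` conv_hull [set` s] by exact: conv_hull_mono.
have ha : conv_hull [set` s] a by exact: sub_conv_hull.
suff ha1 : conv_hull [set` s1] a.
  have e : conv_hull [set` s1] = conv_hull [set` s].
    apply/seteqP; split=> //; apply: (conv_hull_sub (@conv_hull_convex _)).
    move=> x /ss1 /=; rewrite inE => /orP[/eqP->//|xs1]; exact: sub_conv_hull.
  have [|s' e' s'ext] := IHn s1; last by exists s'; rewrite -e.
  rewrite -ltnS; apply: leq_trans sn; rewrite ltnS size_filter.
  rewrite -(count_predC (pred1 a) s) -[X in (X < _)%N]add0n ltn_add2r -has_count.
  by apply/hasP; exists a => //=.
move/not_andP: aNext => -[//|].
move=> /existsNP[y /existsNP[z /existsNP[l]]].
move=> /not_implyP[hy] /not_implyP[hz] /not_implyP[l0] /not_implyP[l1].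
move=> /not_implyP[ea yza].
(* [conv_hull_cons] needs another generator. Without one the hull is [[set a]], where only the
   trivial decomposition exists. *)
have [s1E|/set0P s1N] := eqVneq [set` s1] set0.
  exfalso; apply: yza.
  have sa : conv_hull [set` s] `<=` [set a].
    rewrite -conv_hull1; apply: conv_hull_mono => x /ss1 /=.
    rewrite inE => /orP[/eqP//|xs1]; have : [set` s1] x by [].
    by rewrite s1E.
  by split; apply: sa.
have [al [y' [al0 al1 hy' ey]]] := conv_hull_cons s1N (conv_hull_mono ss1 hy).
have [be [z' [be0 be1 hz' ez]]] := conv_hull_cons s1N (conv_hull_mono ss1 hz).
have k0 : 0 <= l * (1 - al) by rewrite mulr_ge0 ?subr_ge0// ltW.
have k0' : 0 <= (1 - l) * (1 - be) by rewrite mulr_ge0 ?subr_ge0// ltW.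
have [w hw ew] := convex_combine (@conv_hull_convex _) hy' hz' k0 k0'.
(* Both endpoints [y] and [z] are split along [a]. Collecting the multiples of [a] leaves a scalar
   times [a - w], with [w] in the hull of [s1]. A nonzero scalar gives [a = w]; a zero one gives
   [y = z = a], which is excluded. *)
have e : (l * (1 - al) + (1 - l) * (1 - be)) *: (a - w) = 0.
  apply/eqP; rewrite scalerBr -ew subr_eq0; apply/eqP.
  rewrite ey ez !scalerDr !scalerA addrACA -scalerDl in ea.
  move/eqP: ea; rewrite [X in _ == X]addrC -subr_eq => /eqP <-.
  by rewrite -{2}[a]scale1r -scalerBl; congr (_ *: _); ring.
move/eqP: e; rewrite scaler_eq0 => /orP[/eqP k|].
  have e1 : l * (1 - al) = 0 by lra.
  have e2 : (1 - l) * (1 - be) = 0 by lra.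
  exfalso; apply: yza; rewrite ey ez.
  move/eqP: e1; rewrite mulf_eq0 gt_eqF//= subr_eq0 => /eqP <-.
  move/eqP: e2; rewrite mulf_eq0 subr_eq0 gt_eqF//= subr_eq0 => /eqP <-.
  by rewrite subrr !scale0r !addr0 !scale1r.
by rewrite subr_eq0 => /eqP ->.
Qed.

Lemma polytope_finite_extr S : polytope S -> finite_set (extr S).
Proof. by case=> F finF ->; apply: sub_finite_set finF; exact: extr_conv_hull_sub. Qed.

Lemma polytope_sub_convex S C : polytope S -> convex_set C -> extr S `<=` C -> S `<=` C.
Proof.
case=> F /finite_seqP[s ->] -> cC eC.
have [s' e s'e] := conv_hull_seq_extr s; rewrite -e.
by apply: conv_hull_sub; [exact: cC|exact: subset_trans s'e eC].
Qed.

End ConvexHull.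

(** * Polyhedra *)

Section MinkowskiWeyl.
Context {R : realType}.

Definition gen_cone {V : lmodType R} {I : finType} (v : I -> V) : set V :=
  [set x | exists2 c : I -> R, (forall i, 0 <= c i) & x = \sum_i c i *: v i].

Definition pack_scalar {V : lmodType R} (f : V -> R) (lf : scalar f) : {scalar V} :=
  HB.pack f (GRing.isLinear.Build R V R *%R f lf).

Context {V : lmodType R}.

Lemma gen_cone_cone {I : finType} (v : I -> V) : convex_cone (gen_cone v).
Proof.
split.
- by exists (fun=> 0) => //; rewrite big1// => i _; rewrite scale0r.
- move=> _ _ [c c0 ->] [d d0 ->]; exists (fun i => c i + d i).
    by move=> i; rewrite addr_ge0.
  by rewrite -big_split; apply: eq_bigr => i _; rewrite scalerDl.
- move=> a _ a0 [c c0 ->]; exists (fun i => a * c i).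
    by move=> i; rewrite mulr_ge0.
  by rewrite scaler_sumr; apply: eq_bigr => i _; rewrite scalerA.
Qed.

Lemma gen_cone_in {I : finType} (v : I -> V) i : gen_cone v (v i).
Proof.
exists (fun j => (j == i)%:R) => [j|]; first exact: ler0n.
rewrite (bigD1 i)//= eqxx scale1r big1 ?addr0// => j /negbTE ->.
by rewrite scale0r.
Qed.

Lemma gen_cone_sub {I : finType} (v : I -> V) (C : set V) : convex_cone C ->
  (forall i, C (v i)) -> gen_cone v `<=` C.
Proof.
move=> cC Cv _ [c c0 ->]; by apply: convex_cone_sum => // i _; case: cC => _ _; apply.
Qed.

(* The double description step: a generator violating the new constraint is combined with
   each generator that satisfies it strictly, so that the combination is tight. *)
Definition cut_gen {I : finType} (v : I -> V) (a : V -> R) (k : I + I * I) : V :=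
  match k with
  | inl i => if a (v i) <= 0 then v i else 0
  | inr (i, j) => if (0 < a (v i)) && (a (v j) < 0)
                  then a (v i) *: v j - a (v j) *: v i else 0
  end.

Lemma cut_gen_le0 {I : finType} (v : I -> V) (a : {scalar V}) k :
  a (cut_gen v a k) <= 0.
Proof.
case: k => [i|[i j]] /=.
  by case: ifP => //; rewrite linear0.
case: ifP => _; last by rewrite linear0.
by rewrite linearB !scalarZ; lra.
Qed.

Lemma cut_gen_in {I : finType} (v : I -> V) (a : V -> R) k : gen_cone v (cut_gen v a k).
Proof.
have [h0 hD hZ] := gen_cone_cone v.
case: k => [i|[i j]] /=; case: ifP => //; first by move=> _; exact: gen_cone_in.
move=> /andP[ai aj].
rewrite -scaleNr; apply: hD; apply: hZ; try exact: gen_cone_in.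
  exact: ltW.
by rewrite oppr_ge0 ltW.
Qed.

(** On the half-space the total excess [S] of the positive generators is at most the total deficit
    [T] of the negative ones. Each positive generator is spread over the negative ones in proportion
    to their share of [T], which yields tight combinations; the fraction [1 - S / T] of the negative
    part is left over. *)
Lemma gen_cone_cut {I : finType} (v : I -> V) (a : {scalar V}) :
  gen_cone v `&` [set x | a x <= 0] = gen_cone (cut_gen v a).
Proof.
apply/seteqP; split=> [x [[c c0 ex] ax]|x xC]; last first.
  split; first exact: (gen_cone_sub (gen_cone_cone v) (cut_gen_in v a) xC).
  apply: (gen_cone_sub _ (@cut_gen_le0 _ v a) xC).
  split => [|y z|l y] /=; first by rewrite linear0.
    by rewrite linearD; lra.
  by move=> l0 ay; rewrite scalarZ mulr_ge0_le0.
have [h0 hD hZ] := gen_cone_cone (cut_gen v a).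
pose Pos := fun i => 0 < a (v i).
pose Neg := fun i => a (v i) < 0.
pose S := \sum_(i | Pos i) c i * a (v i).
pose T := \sum_(j | Neg j) c j * - a (v j).
have S0 : 0 <= S by apply: sumr_ge0 => i ai; rewrite mulr_ge0// ltW.
have T0 : 0 <= T by apply: sumr_ge0 => i ai; rewrite mulr_ge0// oppr_ge0 ltW.
have hle (i : I) : ~~ Pos i -> gen_cone (cut_gen v a) (v i).
  rewrite -leNgt => ai; have := gen_cone_in (cut_gen v a) (inl i).
  by rewrite /= ai.
have axE : a x = S - T.
  rewrite ex linear_sum (bigID Pos)/=; congr (_ + _).
    by apply: eq_bigr => i _; rewrite scalarZ.
  rewrite (bigID Neg)/= [X in _ + X]big1 ?addr0; last first.
    move=> i /andP[]; rewrite -!leNgt => h1 h2; rewrite scalarZ.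
    by rewrite (_ : a (v i) = 0) ?mulr0//; apply/eqP; rewrite eq_le h1 h2.
  rewrite -sumrN; apply: eq_big => [i|i _]; last by rewrite scalarZ mulrN opprK.
  by rewrite /Pos /Neg; case: ltgtP.
have ST : S <= T by move: ax; rewrite /= axE; lra.
rewrite ex (bigID Pos)/=.
(* With no deficit there is no excess, so every positive generator has coefficient zero. *)
have [TE0|TN0] := eqVneq T 0.
  have SE0 : S = 0 by lra.
  rewrite big1 ?add0r; last first.
    move=> i ai; have := psumr_eq0P _ SE0 ai => /(_ _)/eqP.
    rewrite mulf_eq0 (gt_eqF ai) orbF => /(_ _)/eqP -> //; first by rewrite scale0r.
    by move=> j aj; rewrite mulr_ge0// ltW.
  by apply: convex_cone_sum => [|i /hle hi]; [exact: gen_cone_cone|exact: hZ].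
have T_gt0 : 0 < T by rewrite lt_neqAle eq_sym TN0.
rewrite [X in _ + X](bigID Neg)/= addrA; apply: (hD); last first.
  by apply: convex_cone_sum => [|i /andP[/hle hi _]]; [exact: gen_cone_cone|exact: hZ].
have -> : \sum_(i | ~~ Pos i && Neg i) c i *: v i = \sum_(i | Neg i) c i *: v i.
  by apply: eq_bigl => i; rewrite /Pos /Neg; case: ltgtP.
have -> : \sum_(i | Pos i) c i *: v i + \sum_(i | Neg i) c i *: v i =
    (1 - S / T) *: (\sum_(i | Neg i) c i *: v i) +
    \sum_(i | Pos i) \sum_(j | Neg j) (c i * c j / T) *: (a (v i) *: v j - a (v j) *: v i).
  have -> : \sum_(i | Pos i) \sum_(j | Neg j)
        (c i * c j / T) *: (a (v i) *: v j - a (v j) *: v i) =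
      \sum_(i | Pos i) c i *: v i + (S / T) *: \sum_(j | Neg j) c j *: v j.
    under eq_bigr => i _ do under eq_bigr => j _ do rewrite scalerBr !scalerA.
    under eq_bigr => i _ do rewrite big_split/=.
    rewrite big_split/= addrC; congr (_ + _).
      apply: eq_bigr => i _; under eq_bigr => j _ do rewrite -scaleNr.
      rewrite -scaler_suml; congr (_ *: _).
      transitivity (c i / T * \sum_(j | Neg j) c j * - a (v j)); last by rewrite divfK.
      by rewrite [RHS]mulr_sumr; apply: eq_bigr => j _; field.
    rewrite exchange_big /= scaler_sumr; apply: eq_bigr => j _.
    rewrite -scaler_suml scalerA; congr (_ *: _).
    by rewrite /S !mulr_suml; apply: eq_bigr => i _; field.
  by rewrite scalerBl scale1r addrACA addrA subrK addrC.
have hneg i : Neg i -> gen_cone (cut_gen v a) (c i *: v i).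
  by move=> ai; apply: hZ => //; apply: hle; rewrite -leNgt ltW.
apply: hD.
  apply: hZ; first by rewrite subr_ge0 ler_pdivrMr// mul1r.
  by apply: convex_cone_sum => //; exact: gen_cone_cone.
apply: convex_cone_sum => [|i ai]; first exact: gen_cone_cone.
apply: convex_cone_sum => [|j aj]; first exact: gen_cone_cone.
apply: hZ; first by rewrite divr_ge0 ?mulr_ge0.
have := gen_cone_in (cut_gen v a) (inr (i, j)) => /=.
by rewrite (ai : 0 < _) (aj : _ < 0).
Qed.

Lemma polyhedral_cone_gen {I0 J : finType} (v0 : I0 -> V) (a : J -> {scalar V}) :
  gen_cone v0 = setT ->
  exists (I : finType) (v : I -> V), gen_cone v = [set x | forall j, a j x <= 0].
Proof.
move=> v0T.
suff [I [v vE]] : exists (I : finType) (v : I -> V),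
    gen_cone v = [set x | forall j, j \in enum J -> a j x <= 0].
  exists I, v; rewrite vE; apply/seteqP; split=> x h j; last by move=> _; exact: h.
  by apply: h; rewrite mem_enum.
elim: (enum J) => [|j s [I [v vE]]].
  by exists I0, v0; rewrite v0T; apply/seteqP; split=> [x _ j|].
exists (I + I * I)%type, (cut_gen v (a j)); rewrite -gen_cone_cut vE.
apply/seteqP; split=> [x [hs ha] k /=|x /= h].
  by rewrite inE => /orP[/eqP->|]; [exact: ha|exact: hs].
by split=> [k ks|]; apply: h; rewrite inE ?eqxx ?ks ?orbT.
Qed.

End MinkowskiWeyl.

Lemma linear_combination_mxE {R : pzSemiRingType} {m n : nat} (k : R) (A B : 'M[R]_(m, n)) i j :
  (k *: A + B) i j = k * A i j + B i j.
Proof. by rewrite !mxE. Qed.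

(** * Generators of a polyhedron and its Minkowski-Weyl decomposition *)

Section Polyhedra.
Context {R : realType} {n : nat}.
Implicit Types (S : set 'cV[R]_n).

Definition recession S : set 'cV[R]_n :=
  [set f | forall x c, S x -> 0 <= c -> S (x + c *: f)].

Lemma recession_cone S : convex_cone (recession S).
Proof.
split=> [x c Sx c0|f f' rf rf' x c Sx c0|a f a0 rf x c Sx c0].
- by rewrite scaler0 addr0.
- by rewrite scalerDr addrA; apply: rf' => //; apply: rf.
- by rewrite scalerA; apply: rf => //; rewrite mulr_ge0.
Qed.

(* [g i] at height [t i] generates the homogenised cone {(x, h) | x in h S}. *)
Lemma polyhedral_generators S : polyhedral S ->
  exists (I : finType) (g : I -> 'cV[R]_n) (t : I -> R),
    [/\ forall i, 0 <= t i,
        forall i, 0 < t i -> S ((t i)^-1 *: g i),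
        S = [set x | exists c : I -> R,
               [/\ forall i, 0 <= c i, \sum_i c i * t i = 1 & x = \sum_i c i *: g i]]
      & forall i, t i = 0 -> recession S (g i)].
Proof.
move=> [p [G [h SE]]].
pose V := ('cV[R]_n * R^o)%type.
pose rowf i (z : V) : R := (G *m z.1) i 0 - h i 0 * z.2.
have rowf_lin i : scalar (rowf i).
  move=> k y z; rewrite /rowf.
  have -> : (k *: y + z).1 = k *: y.1 + z.1 by [].
  have -> : (k *: y + z).2 = k * y.2 + z.2 :> R by [].
  rewrite mulmxDr -scalemxAr linear_combination_mxE; ring.
have negh_lin : scalar (fun z : V => - z.2 : R).
  by move=> k y z /=; rewrite opprD mulrN.
(* [Some i] is the homogenised inequality of row [i], and [None] requires a nonnegative height. *)
pose con o := if o is Some i then pack_scalar (rowf_lin i) else pack_scalar negh_lin.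
(* The signed basis vectors generate the whole space, from which the constraints are cut one by
   one. *)
pose v0 (k : bool * option 'I_n) : V :=
  let e : V := if k.2 is Some i then (delta_mx i 0, 0) else (0, 1) in
  if k.1 then e else - e.
have v0T : gen_cone v0 = setT.
  apply/seteqP; split=> // z _.
  have [C0 CD CZ] := gen_cone_cone v0.
  have CZ' (a : R) o : gen_cone v0 (a *: v0 (true, o)).
    have [a0|a0] := leP 0 a; first by apply: CZ => //; exact: gen_cone_in.
    rewrite -[a]opprK scaleNr -scalerN.
    apply: CZ; first by rewrite oppr_ge0 ltW.
    by have := gen_cone_in v0 (false, o).
  have -> : z = \sum_i z.1 i 0 *: v0 (true, Some i) + z.2 *: v0 (true, None).
    rewrite [LHS]surjective_pairing; congr pair => /=.
      rewrite (big_morph fst (id1 := 0) (op1 := +%R))// scaler0 addr0 /=.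
      rewrite [LHS]matrix_sum_delta; apply: eq_bigr => i _.
      by rewrite big_ord1.
    rewrite (big_morph snd (id1 := 0) (op1 := +%R))// big1 ?add0r.
      by rewrite /GRing.scale/= mulr1.
    by move=> i _ /=; rewrite scaler0.
  by apply: CD => //; apply: convex_cone_sum => [|i _]; [exact: gen_cone_cone|exact: CZ'].
have [I [v vE]] := polyhedral_cone_gen con v0T.
have mem_s z : gen_cone v z <-> 0 <= z.2 /\ forall i, (G *m z.1) i 0 <= h i 0 * z.2.
  rewrite vE /=; split=> [H|[z0 Hz] [i|] /=].
  - split=> [|i]; first by have := H None; rewrite /= oppr_le0.
    by have := H (Some i); rewrite /= /rowf subr_le0.
  - by rewrite /rowf subr_le0.
  - by rewrite oppr_le0.
have vP i := (mem_s (v i)).1 (gen_cone_in v i).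
have sum1 (c : I -> R) : (\sum_i c i *: v i).1 = \sum_i c i *: (v i).1.
  by rewrite (big_morph fst (id1 := 0) (op1 := +%R)).
have sum2 (c : I -> R) : (\sum_i c i *: v i).2 = \sum_i c i * (v i).2.
  by rewrite (big_morph snd (id1 := 0) (op1 := +%R)).
have SP x : S x <-> gen_cone v (x, 1).
  rewrite mem_s /= SE /=; split=> [H|[_ H] i]; last by have := H i; rewrite mulr1.
  by split=> [|i]; [exact: ler01|rewrite mulr1].
exists I, (fun i => (v i).1), (fun i => (v i).2); split.
- by move=> i; have [] := vP i.
- move=> i ti; apply/SP; have [_ _ CZ] := gen_cone_cone v.
  have tV : 0 <= (v i).2^-1 :> R by rewrite invr_ge0 ltW.
  have := CZ _ _ tV (gen_cone_in v i); congr gen_cone.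
  by rewrite [LHS]surjective_pairing; congr pair; exact: mulVf (lt0r_neq0 ti).
- apply/seteqP; split=> x /=.
    move=> /SP[c c0 e]; exists c; split=> //.
      by rewrite -sum2 -e.
    by rewrite -sum1 -e.
  move=> [c [c0 c1 ->]]; apply/SP; exists c => //.
  by rewrite [RHS]surjective_pairing sum1 sum2 c1.
- move=> i ti x c; rewrite SE /= => Hx c0 j.
  have [_ /(_ j)] := vP i; rewrite ti mulr0 => Hj.
  rewrite mulmxDr -scalemxAr !mxE -[leRHS]addr0 lerD//.
    by have := Hx j; rewrite mxE.
  by have := Hj; rewrite mxE => Hj'; rewrite mulr_ge0_le0.
Qed.

(** Generators of positive height, rescaled to height one, give the polytope of points; those of
    height zero give the directions. *)
Lemma polyhedral_minkowski_weyl S : polyhedral S ->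
  exists Ge Gr : set 'cV[R]_n, [/\ polytope Ge, polytope Gr &
    S = [set e + f | e in Ge & f in conic_hull Gr]].
Proof.
move=> pS.
have cS : convex_set S.
  case: pS => [p [G [h ->]]]; apply/convex_setP => x y l Hx Hy l0 l1 i /=.
  rewrite mulmxDr -!scalemxAr !mxE.
  have := ler_wpM2l l0 (Hx i); have := ler_wpM2l _ (Hy i) => /(_ (1 - l)).
  by rewrite subr_ge0 => /(_ l1); rewrite !mxE; lra.
have [I [g [t [t0 SFe SE rec]]]] := polyhedral_generators pS.
pose Fe : set 'cV[R]_n := [set (t i)^-1 *: g i | i in [set i | 0 < t i]].
pose Fr := [set g i | i in [set i | t i = 0]].
exists (conv_hull Fe), (conv_hull Fr); split.
- by exists Fe => //; apply: finite_image.
- by exists Fr => //; apply: finite_image.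
apply/seteqP; split=> [x|_ [e he [f hf <-]]]; last first.
  have Se : S e by apply: conv_hull_sub he => // _ [i ti <-]; exact: SFe.
  have rf : recession S f.
    apply: conic_hull_sub hf; first exact: recession_cone.
    apply: conv_hull_sub; first exact: convex_cone_convex (recession_cone S).
    by move=> _ [i ti <-]; apply: rec.
  by have := rf _ _ Se ler01; rewrite scale1r.
rewrite SE => -[c [c0 c1 ->]].
have ct0 i : 0 <= c i * t i by rewrite mulr_ge0.
have [] := @convex_combine_sum _ _ (conv_hull Fe) _ (fun i => c i * t i)
  (fun i => (t i)^-1 *: g i) (@conv_hull_convex _ _ _) _ ct0.
(* The heights sum to one, so some generator has positive height and the hull of [Fe] is
   nonempty. *)
- have [i /eqP ti] : exists i, c i * t i != 0.
    apply: contrapT => /forallNP H; move: c1; rewrite big1 => [/eqP|i _].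
      by rewrite eq_sym oner_eq0.
    by apply/eqP; rewrite -[_ == _]negbK; apply/negP/H.
  exists ((t i)^-1 *: g i); apply: sub_conv_hull; exists i => //=.
  rewrite lt_neqAle t0 andbT eq_sym; apply: contra_notN ti => /eqP ->.
  by rewrite mulr0.
- move=> i cti; apply: sub_conv_hull; exists i => //=.
  rewrite lt_neqAle t0 andbT eq_sym; apply: contraNN cti => /eqP ->.
  by rewrite mulr0.
move=> w hw; rewrite c1 scale1r => ew.
exists w => //; exists (\sum_(i | t i == 0) c i *: g i).
  apply: convex_cone_sum => [|i /eqP ti]; first exact: conic_hull_cone.
  have [_ _ CZ] := conic_hull_cone (conv_hull Fr); apply: CZ => //.
  by apply: sub_conic_hull; apply: sub_conv_hull; exists i.
rewrite -ew [RHS](bigID (fun i => t i == 0))/= addrC; congr (_ + _).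
rewrite (bigID (fun i => t i == 0))/= big1 ?add0r => [|i /eqP ->]; last first.
  by rewrite mulr0 scale0r.
by apply: eq_bigr => i ti; rewrite scalerA mulfK.
Qed.

End Polyhedra.

(** * Closed images of quadratic maps *)

Section QuadraticImage.
Context {R : realType} {I : finType} {p : nat} (phi : I -> 'rV[R]_p -> R).
Hypothesis phi_cont : forall i, continuous (phi i).
Hypothesis phiZ : forall i (a : R) u, phi i (a *: u) = a ^+ 2 * phi i u.
Hypothesis phi_eq0 : forall u, (forall i, phi i u = 0) -> u = 0.

Lemma continuous_bigsum {T : topologicalType} (f : I -> T -> R) :
  (forall i, continuous (f i)) -> continuous (fun x => \sum_i f i x).
Proof.
move=> cf; elim: (index_enum I) => [|i s IHs].
  by under eq_fun do rewrite big_nil; exact: cst_continuous.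
under eq_fun do rewrite big_cons.
by move=> x; apply: continuousD; [exact: cf|exact: IHs].
Qed.

(** The sum of squares is continuous, homogeneous of degree four and positive on the unit sphere, so
    its minimum there is a positive constant. *)
Lemma quadratic_coercive : exists2 c : R, 0 < c &
  forall u, c * `|u| ^+ 4 <= \sum_i phi i u ^+ 2.
Proof.
pose f u := \sum_i phi i u ^+ 2.
pose A := [set u : 'rV[R]_p | `|u| = 1].
have f0 u : 0 <= f u by apply: sumr_ge0 => i _; exact: sqr_ge0.
have fcont : continuous f.
  by apply: continuous_bigsum => i u; apply: continuousM; exact: phi_cont.
have nA u : u != 0 -> A (`|u|^-1 *: u).
  by move=> u0; rewrite /A /= normrZ normfV normr_id mulVf// normr_eq0.
have [c c0 hc] : exists2 c, 0 < c & forall u, A u -> c <= f u.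
  (* The sphere is empty when [p = 0]; any positive constant then works. *)
  have [A0|/set0P A0] := eqVneq A set0.
    by exists 1 => // u Au; exfalso; have : set0 u by rewrite -A0.
  have cA : compact A.
    apply: bounded_closed_compact.
      exists 1; split; first by rewrite num_real.
      by move=> M M1 u /= ->; exact: ltW.
    apply: (@closed_comp _ _ (fun u : 'rV[R]_p => `|u|) [set 1]).
      by move=> u _; exact: norm_continuous.
    exact: closed_eq.
  have [u /set_mem Au minu] := compact_EVT_min A0 cA (continuous_subspaceT fcont).
  exists (f u); last by move=> w Aw; apply: minu; exact: mem_set.
  rewrite lt_neqAle f0 andbT eq_sym; apply/eqP => fu0.
  have u0 : u = 0.
    apply: phi_eq0 => i; apply/eqP; rewrite -sqrf_eq0; apply/eqP.
    by apply: (psumr_eq0P _ fu0) => // j _; exact: sqr_ge0.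
  by move: Au; rewrite /A /= u0 normr0 => /eqP; rewrite eq_sym oner_eq0.
exists c => // u; have [->|u0] := eqVneq u 0.
  by rewrite normr0 expr0n mulr0; exact: f0.
have := hc _ (nA _ u0); rewrite /f.
under eq_bigr do rewrite phiZ exprMn -exprM exprVn mulrC.
by rewrite -mulr_suml ler_pdivlMr// exprn_gt0// normr_gt0.
Qed.

Hypothesis phiD : forall u w, exists z, forall i, phi i z = phi i u + phi i w.

(* The image of [phi] is a closed convex cone: minimise the distance to [y]. Optimality says that
   the residual [y - phi u] is nonpositive on the cone and orthogonal to [phi u]. *)
Lemma quadratic_image_duality (y : I -> R) :
  (forall g : I -> R, (forall u, 0 <= \sum_i g i * phi i u) -> 0 <= \sum_i g i * y i) ->
  exists u, forall i, phi i u = y i.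
Proof.
move=> dual.
pose g u := \sum_i (phi i u - y i) ^+ 2.
have gcont : continuous g.
  apply: continuous_bigsum => i u.
  have c1 : {for u, continuous (fun u => phi i u - y i)}.
    by apply: continuousB; [exact: phi_cont|exact: cst_continuous].
  exact: (continuousM c1 c1).
have phi0 i : phi i 0 = 0 by rewrite -(scale0r (0 : 'rV[R]_p)) phiZ expr0n mul0r.
have [c c0 hc] := quadratic_coercive.
pose Y := \sum_i y i ^+ 2.
have Y0 : 0 <= Y by apply: sumr_ge0 => i _; exact: sqr_ge0.
(* Outside the ball of this radius, [g u >= c * rho / 2 - Y = c / 2 + Y], which exceeds [g 0 = Y]. A
   minimiser over the ball is therefore global. *)
pose rho : R := 1 + 4 * Y / c.
have rho1 : 1 <= rho by rewrite lerDl divr_ge0 ?mulr_ge0// ltW.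
pose B := [set u : 'rV[R]_p | `|u| <= rho].
have [u0 hu0] : exists u0, forall u, g u0 <= g u.
  have B0 : B 0 by rewrite /B /= normr0 (le_trans _ rho1).
  have cB : compact B.
    apply: bounded_closed_compact.
      exists rho; split; first by rewrite num_real.
      by move=> M M1 u /= /le_trans; apply; exact: ltW.
    apply: (@closed_comp _ _ (fun u : 'rV[R]_p => `|u|) [set x | x <= rho]).
      by move=> u _; exact: norm_continuous.
    exact: closed_le.
  have [u0 _ minu] := compact_EVT_min (ex_intro _ _ B0) cB (continuous_subspaceT gcont).
  exists u0 => u; have [uB|/ltW uB] := leP `|u| rho.
    by apply: minu; exact: mem_set.
  apply: (le_trans (minu _ (mem_set B0))).
  have -> : g 0 = Y by apply: eq_bigr => i _; rewrite phi0 sub0r sqrrN.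
  have h1 : (\sum_i phi i u ^+ 2) / 2 - Y <= g u.
    rewrite mulr_suml -sumrB; apply: ler_sum => i _.
    by have := sqr_ge0 (phi i u / 2 - y i); have := sqr_ge0 (phi i u); nra.
  have h2 : rho <= `|u| ^+ 4.
    rewrite (le_trans uB)// -[leLHS]expr1 ler_weXn2l//.
    exact: le_trans rho1 uB.
  have h3 := ler_wpM2l (ltW c0) h2; have h4 := hc u.
  have h5 : c * rho = c + 4 * Y by rewrite /rho; field; rewrite gt_eqF.
  lra.
pose r i := y i - phi i u0.
pose nrm (w : 'rV[R]_p) := \sum_i phi i w ^+ 2.
have nrm0 w : 0 <= nrm w by apply: sumr_ge0 => i _; exact: sqr_ge0.
have gE w e z : (forall i, phi i z = phi i u0 + e * phi i w) ->
    g z = g u0 - 2 * e * (\sum_i r i * phi i w) + e ^+ 2 * nrm w.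
  move=> ez; rewrite /g /nrm !mulr_sumr -sumrB -big_split/=.
  by apply: eq_bigr => i _; rewrite ez /r; ring.
(* If [a] were positive, the step [e = a / (a + b + 1)] would satisfy [e * b <= a], against
   [2 * a <= e * b]. *)
have small (a b : R) : 0 <= b -> (forall e, 0 < e -> e < 1 -> 2 * e * a <= e ^+ 2 * b) -> a <= 0.
  move=> b0 h; rewrite leNgt; apply/negP => a0.
  pose e := a / (a + b + 1); have d0 : 0 < a + b + 1 by lra.
  have e0 : 0 < e by rewrite divr_gt0.
  have e1 : e < 1 by rewrite ltr_pdivrMr// mul1r; lra.
  have h1 : 2 * a <= e * b by rewrite -(ler_pM2l e0); have := h e e0 e1; lra.
  have h2 : e * b <= a by rewrite mulrAC ler_pdivrMr// ler_pM2l//; lra.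
  lra.
(* Since the image is a cone closed under addition, it contains [phi u0 + e * phi w], which cannot
   be closer to [y]. *)
have rle w : \sum_i r i * phi i w <= 0.
  apply: (small _ _ (nrm0 w)) => e e0 e1.
  have [z ez] := phiD u0 (Num.sqrt e *: w).
  have ez' i : phi i z = phi i u0 + e * phi i w by rewrite ez phiZ sqr_sqrtr// ltW.
  by have := hu0 z; rewrite (gE w e z ez'); lra.
(* Moving towards the origin: the factor [Num.sqrt (1 - e)] on [u0] scales its image by [1 - e]. *)
have rge : 0 <= \sum_i r i * phi i u0.
  rewrite -oppr_le0; apply: (small _ _ (nrm0 u0)) => e e0 e1.
  have ez i : phi i (Num.sqrt (1 - e) *: u0) = phi i u0 + - e * phi i u0.
    by rewrite phiZ sqr_sqrtr ?subr_ge0 1?ltW//; ring.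
  by have := hu0 (Num.sqrt (1 - e) *: u0); rewrite (gE u0 (- e) _ ez) sqrrN; lra.
(* By [rle] the functional [- r] is admissible in [dual], and [y] is the sum of [r] and [phi u0]. *)
have rr : \sum_i r i ^+ 2 <= 0.
  have negr z : \sum_i - r i * z i = - \sum_i r i * z i.
    by rewrite -sumrN; apply: eq_bigr => i _; rewrite mulNr.
  have : 0 <= \sum_i - r i * y i.
    by apply: dual => u; rewrite (negr (phi ^~ u)) oppr_ge0.
  have -> : \sum_i - r i * y i = - (\sum_i r i ^+ 2 + \sum_i r i * phi i u0).
    by rewrite -big_split/= -sumrN; apply: eq_bigr => i _; rewrite /r; ring.
  lra.
exists u0 => i; apply/esym/eqP; rewrite -subr_eq0 -sqrf_eq0; apply/eqP.
have /psumr_eq0P -> // : \sum_i r i ^+ 2 = 0.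
  by apply/eqP; rewrite eq_le rr sumr_ge0// => j _; exact: sqr_ge0.
by move=> j _; exact: sqr_ge0.
Qed.

End QuadraticImage.

(** * Positive semidefinite matrices *)

Section PSD.
Context {R : realType}.

Definition dot {n} (u v : 'cV[R]_n) : R := (u^T *m v) 0 0.
Definition qform {n} (M : 'M[R]_n) (v : 'cV[R]_n) : R := (v^T *m M *m v) 0 0.

Lemma dotE {n} (u v : 'cV[R]_n) : dot u v = \sum_i u i 0 * v i 0.
Proof. by rewrite /dot mxE; apply: eq_bigr => i _; rewrite mxE. Qed.

Lemma dotC {n} (u v : 'cV[R]_n) : dot u v = dot v u.
Proof. by rewrite !dotE; apply: eq_bigr => i _; rewrite mulrC. Qed.

Lemma dotDl {n} (u v w : 'cV[R]_n) : dot (u + v) w = dot u w + dot v w.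
Proof. by rewrite !dotE -big_split/=; apply: eq_bigr => i _; rewrite mxE mulrDl. Qed.

Lemma dotZl {n} k (u w : 'cV[R]_n) : dot (k *: u) w = k * dot u w.
Proof. by rewrite !dotE mulr_sumr; apply: eq_bigr => i _; rewrite mxE mulrA. Qed.

Lemma dotDr {n} (u v w : 'cV[R]_n) : dot w (u + v) = dot w u + dot w v.
Proof. by rewrite !(dotC w) dotDl. Qed.

Lemma dotZr {n} k (u w : 'cV[R]_n) : dot w (k *: u) = k * dot w u.
Proof. by rewrite !(dotC w) dotZl. Qed.

Lemma dot0r {n} (u : 'cV[R]_n) : dot u 0 = 0.
Proof. by rewrite -(scale0r 0) dotZr mul0r. Qed.

Lemma dot_ge0 {n} (u : 'cV[R]_n) : 0 <= dot u u.
Proof. by rewrite dotE; apply: sumr_ge0 => i _; rewrite -expr2 sqr_ge0. Qed.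

Lemma dot_eq0 {n} (u : 'cV[R]_n) : dot u u = 0 -> u = 0.
Proof.
rewrite dotE => /psumr_eq0P e; apply/colP => i; rewrite mxE; apply/eqP.
rewrite -sqrf_eq0 expr2; apply/eqP/e => // j _.
by rewrite -expr2 sqr_ge0.
Qed.

Lemma dot_mulmx {n m} (M : 'M[R]_(n, m)) u v : dot u (M *m v) = dot (M^T *m u) v.
Proof. by rewrite /dot trmx_mul trmxK mulmxA. Qed.

Lemma qformE {n} (M : 'M[R]_n) v : qform M v = dot v (M *m v).
Proof. by rewrite /qform /dot mulmxA. Qed.

Lemma qformD {n} (M M' : 'M[R]_n) v : qform (M + M') v = qform M v + qform M' v.
Proof. by rewrite !qformE mulmxDl dotDr. Qed.

Lemma qformZ {n} k (M : 'M[R]_n) v : qform (k *: M) v = k * qform M v.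
Proof. by rewrite !qformE -scalemxAl dotZr. Qed.

Lemma dot_suml {n} {I : finType} (F : I -> 'cV[R]_n) v :
  dot (\sum_i F i) v = \sum_i dot (F i) v.
Proof.
apply: (big_morph (dot ^~ v)) => [x y|]; first exact: dotDl.
by rewrite dotC dot0r.
Qed.

Lemma qform_sum {n} {I : finType} (F : I -> 'M[R]_n) v :
  qform (\sum_i F i) v = \sum_i qform (F i) v.
Proof.
apply: (big_morph (qform ^~ v)) => [M M'|]; first exact: qformD.
by rewrite qformE mul0mx dot0r.
Qed.

Lemma qform_scale {n} k (M : 'M[R]_n) v : qform M (k *: v) = k ^+ 2 * qform M v.
Proof. by rewrite !qformE -scalemxAr dotZr dotZl mulrA. Qed.

Lemma qform_add {n} (M : 'M[R]_n) u v : M^T = M ->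
  qform M (u + v) = qform M u + 2 * dot u (M *m v) + qform M v.
Proof.
move=> sM; rewrite !qformE mulmxDr !dotDl !dotDr.
have -> : dot v (M *m u) = dot u (M *m v) by rewrite dot_mulmx sM dotC.
ring.
Qed.

Lemma qform_outer {n} (x v : 'cV[R]_n) : qform (x *m x^T) v = dot x v ^+ 2.
Proof.
rewrite qformE -mulmxA [x^T *m v]mx11_scalar mul_mx_scalar dotZr -/(dot x v).
by rewrite (dotC v) expr2.
Qed.

Lemma qform_trace {n} (M : 'M[R]_n) v : qform M v = \tr (M *m (v *m v^T)).
Proof. by rewrite mulmxA mxtrace_mulC mulmxA /mxtrace big_ord1. Qed.

Lemma qform_block {n} a (w : 'cV[R]_n) M s u :
  qform (block_mx a%:M w^T w M : 'M[R]_(1 + n)) (col_mx s%:M u) =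
  a * s ^+ 2 + 2 * s * dot w u + qform M u.
Proof.
have addE (A B : 'M[R]_1) : (A + B) 0 0 = A 0 0 + B 0 0 by rewrite mxE.
rewrite /qform tr_col_mx mul_row_block mul_row_col !mulmxDl !addE tr_scalar_mx.
have -> : (s%:M *m a%:M *m s%:M : 'M[R]_1) 0 0 = s * a * s.
  by rewrite -!scalar_mxM mxE eqxx mulr1n.
have -> : (u^T *m w *m s%:M) 0 0 = s * dot w u.
  by rewrite mul_mx_scalar mxE -/(dot u w) dotC.
have -> : (s%:M *m w^T *m u) 0 0 = s * dot w u.
  by rewrite mul_scalar_mx -scalemxAl mxE.
ring.
Qed.

Lemma col_mx_scalar {n} (v : 'cV[R]_(1 + n)) :
  v = col_mx (usubmx v 0 0)%:M (dsubmx v).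
Proof. by rewrite -mx11_scalar vsubmxK. Qed.

Lemma psdP {n} (M : 'M[R]_n) : psd M <-> M^T = M /\ forall v, 0 <= qform M v.
Proof. by []. Qed.

Lemma psd0 {n} : psd (0 : 'M[R]_n).
Proof. by apply/psdP; split=> [|v]; rewrite ?trmx0// qformE mul0mx dot0r. Qed.

Lemma psdD {n} (M M' : 'M[R]_n) : psd M -> psd M' -> psd (M + M').
Proof.
move=> /psdP[sM pM] /psdP[sM' pM']; apply/psdP; split=> [|v].
  by rewrite linearD/= sM sM'.
by rewrite qformD addr_ge0.
Qed.

Lemma psdZ {n} k (M : 'M[R]_n) : 0 <= k -> psd M -> psd (k *: M).
Proof.
move=> k0 /psdP[sM pM]; apply/psdP; split=> [|v]; first by rewrite linearZ/= sM.
by rewrite qformZ mulr_ge0.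
Qed.

Lemma psd_gram {n m} (B : 'M[R]_(n, m)) : psd (B *m B^T).
Proof.
apply/psdP; split=> [|v]; first by rewrite trmx_mul trmxK.
by rewrite qformE -mulmxA dot_mulmx dot_ge0.
Qed.

(** The convention that the inverse of 0 is 0 lets one statement cover a zero pivot: the middle
    clause then says [w = 0]. *)
Lemma psd_schur {n} a (w : 'cV[R]_n) M :
  psd (block_mx a%:M w^T w M : 'M[R]_(1 + n)) ->
  [/\ 0 <= a, a * a^-1 *: w = w & psd (M - a^-1 *: (w *m w^T))].
Proof.
move=> /psdP[sY pY].
have pY' s u : 0 <= a * s ^+ 2 + 2 * s * dot w u + qform M u.
  by rewrite -qform_block.
have a0 : 0 <= a by have := pY' 1 0; rewrite dot0r qformE mulmx0 dot0r; lra.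
have sM : M^T = M by move: sY; rewrite tr_block_mx => /eq_block_mx[].
have qM u : 0 <= qform (M - a^-1 *: (w *m w^T)) u.
  rewrite -scaleNr qformD qformZ qform_outer.
  have [->|aN0] := eqVneq a 0; first by have := pY' 0 u; rewrite invr0; lra.
  (* This value of [s] minimises the bordered form for fixed [u]. *)
  have := pY' (- a^-1 * dot w u) u.
  rewrite (_ : a * _ + _ = - a^-1 * dot w u ^+ 2); first by rewrite addrC.
  by field.
split=> //; last first.
  by apply/psdP; split=> //; rewrite linearB linearZ/= trmx_mul trmxK sM.
have [a00|aN0] := eqVneq a 0; last by rewrite divff// scale1r.
rewrite a00 mul0r scale0r; apply/esym/dot_eq0/eqP; rewrite eq_le dot_ge0 andbT leNgt.
apply/negP => d0; set d := dot w w in d0.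
(* With a zero pivot the form is affine in [s]; this choice makes its value [-1]. *)
have h := pY' (- (qform M w + 1) / (2 * d)) w.
rewrite a00 -/d mul0r add0r in h.
by move: h; rewrite (_ : _ * d = - (qform M w + 1)); [lra|field; rewrite gt_eqF].
Qed.

(** Cholesky factorisation by induction on the size: the pivot and its column, divided by
    [Num.sqrt a], form the first column of the factor, and the Schur complement supplies the
    rest. *)
Lemma psd_gramP {n} (M : 'M[R]_n) : psd M -> exists B : 'M[R]_n, M = B *m B^T.
Proof.
elim: n M => [|n IHn] M pM; first by exists 0; apply/matrixP; case.
pose M' : 'M[R]_(1 + n) := M.
pose a := ulsubmx M' 0 0; pose w := dlsubmx M'; pose D := drsubmx M'.
have ME : M' = block_mx a%:M w^T w D.
  rewrite -[LHS]submxK; congr block_mx; first by rewrite [LHS]mx11_scalar.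
  by rewrite /w trmx_dlsub (pM.1 : M'^T = M').
have [a0 aw psS] : [/\ 0 <= a, a * a^-1 *: w = w & psd (D - a^-1 *: (w *m w^T))].
  by apply: psd_schur; rewrite -ME.
have [B eB] := IHn _ psS.
pose s := Num.sqrt a.
have ss : s * s = a by rewrite -expr2 sqr_sqrtr.
have ssV : s^-1 * s^-1 = a^-1 by rewrite -invfM ss.
pose L : 'M[R]_(1 + n) := block_mx s%:M 0 (s^-1 *: w) B.
suff eL : M' = L *m L^T by exists L.
rewrite ME tr_block_mx mulmx_block tr_scalar_mx !linearZ/= !trmx0.
rewrite mulmx0 !mul0mx !addr0 -scalar_mxM ss.
(* A zero pivot forces [w = 0], so the division by [s] loses nothing. *)
have sw : (s * s^-1) *: w = w.
  have [s0|sN0] := eqVneq s 0; last by rewrite divff// scale1r.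
  by rewrite (_ : w = 0) ?scaler0// -aw -ss s0 !mul0r scale0r.
congr block_mx.
- by rewrite mul_scalar_mx scalerA mulrC -{1}sw linearZ.
- by rewrite mulmx0 addr0 mul_mx_scalar scalerA sw.
- by rewrite -scalemxAl scalerA ssV -eB addrC subrK.
Qed.

Lemma trace_gram {n} (A B : 'M[R]_n) :
  \tr (A *m (B *m B^T)) = \sum_j qform A (col j B).
Proof.
rewrite mulmxA mxtrace_mulC mulmxA /mxtrace; apply: eq_bigr => j _.
rewrite /qform tr_col -row_mul [LHS]mxE [RHS]mxE; apply: eq_bigr => k _.
by rewrite [row _ _ _ _]mxE [col _ _ _ _]mxE.
Qed.

Lemma psd_trace_ge0 {n} (A W : 'M[R]_n) : psd A -> psd W -> 0 <= \tr (A *m W).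
Proof.
move=> /psdP[_ pA] /psd_gramP[B ->]; rewrite trace_gram.
by apply: sumr_ge0 => j _; exact: pA.
Qed.

Lemma pd_psd {n} (A : 'M[R]_n) : pd A -> psd A.
Proof.
move=> [sA pA]; split=> // v; have [->|v0] := eqVneq v 0; last exact/ltW/pA.
by rewrite mulmx0 mxE.
Qed.

(** For [W = B B^T] the trace is the sum of the values of the form at the columns of [B]. These are
    nonnegative, hence all zero, and definiteness kills each column. *)
Lemma pd_trace_eq0 {n} (A W : 'M[R]_n) : pd A -> psd W -> \tr (A *m W) <= 0 -> W = 0.
Proof.
move=> pA /psd_gramP[B ->]; rewrite trace_gram => le0.
have [_ qA] := pd_psd pA.
have e0 j : qform A (col j B) = 0.
  have /psumr_eq0P -> // : \sum_j qform A (col j B) = 0; last by move=> k _; exact: qA.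
  by apply/eqP; rewrite eq_le le0 sumr_ge0// => k _; exact: qA.
suff -> : B = 0 by rewrite mul0mx.
apply/matrixP => i j.
have [e|/eqP colN0] := pselect (col j B = 0).
  by have /colP/(_ i) := e; rewrite !mxE.
by have := pA.2 _ colN0; rewrite -/(qform _ _) e0 ltxx.
Qed.

Lemma psd_ker {n} (A : 'M[R]_n) v : psd A -> qform A v = 0 -> A *m v = 0.
Proof.
move=> /psd_gramP[B ->]; rewrite qformE -mulmxA dot_mulmx.
by move=> /dot_eq0 ->; rewrite mulmx0.
Qed.

Lemma gram_eq0 {n m} (B : 'M[R]_(n, m)) : B *m B^T = 0 -> B = 0.
Proof.
move=> e; apply/matrixP => i j; rewrite mxE.
have /dot_eq0/colP/(_ j) : dot (row i B)^T (row i B)^T = 0.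
  have /matrixP/(_ i i) := e; rewrite !mxE dotE => eii; rewrite -[RHS]eii.
  by apply: eq_bigr => k _; rewrite !mxE.
by rewrite !mxE.
Qed.

Lemma psd_border {n} (x : 'cV[R]_n) X : X^T = X ->
  psd (block_mx 1%:M x^T x X : 'M[R]_(1 + n)) <-> psd (X - x *m x^T).
Proof.
move=> sX; split=> [/psd_schur[_ _]|[_ pS]]; first by rewrite invr1 scale1r.
split; first by rewrite tr_block_mx tr_scalar_mx trmxK sX.
move=> v; rewrite [v]col_mx_scalar -/(qform _ _) qform_block.
set s := _ 0 0; set u := dsubmx v.
(* Completing the square: the bordered form is [(s + dot x u) ^+ 2] plus the form of [X - x x^T] at
   [u]. *)
have := pS u; rewrite -/(qform _ _) -scaleN1r qformD qformZ qform_outer.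
by have := sqr_ge0 (s + dot x u); lra.
Qed.

End PSD.

(** * Aggregated quadratics *)

Section Quadratics.
Context {R : realType} {N : nat}.
Implicit Types (q : quadratic R N) (x y v : 'cV[R]_N).

Lemma qevalE q x : qeval q x = qform (qA q) x + 2 * dot (qb q) x + qc q.
Proof. by []. Qed.

Lemma qeval_line q x v a : qeval q (x + a *: v) =
  qeval q x + 2 * a * (dot x (qA q *m v) + dot (qb q) v) + a ^+ 2 * qform (qA q) v.
Proof.
rewrite !qevalE qform_add ?qA_sym// -scalemxAr !dotDr !dotZr qform_scale; ring.
Qed.

Lemma qeval_convex q x y l : psd (qA q) -> 0 <= l -> l <= 1 ->
  qeval q (l *: x + (1 - l) *: y) <= l * qeval q x + (1 - l) * qeval q y.
Proof.
move=> [_ pA] l0 l1; set v := x - y.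
have -> : l *: x + (1 - l) *: y = y + l *: v.
  by rewrite /v scalerBr scalerBl scale1r addrCA.
have -> : x = y + 1 *: v by rewrite scale1r addrC subrK.
(* The convexity gap along the segment is exactly [l * (1 - l) * qform (qA q) v]. *)
have h := pA v; have h2 : 0 <= l * (1 - l) by rewrite mulr_ge0// subr_ge0.
have := mulr_ge0 h2 h; rewrite !qeval_line -/(qform _ _); lra.
Qed.

(** The trace against the Schur complement [X - x x^T] measures how far the lifted value differs
    from the original quadratic. *)
Lemma frob_qmx q x X : X^T = X ->
  frob (qmx q) (block_mx 1%:M x^T x X) = qeval q x + \tr (qA q *m (X - x *m x^T)).
Proof.
move=> sX; rewrite /frob /qmx tr_block_mx mulmx_block mxtrace_block.
rewrite tr_scalar_mx trmxK qA_sym qevalE mulmxBr linearB/= -qform_trace.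
rewrite !mxtraceD [\tr (_ *m 1%:M)]mxtrace_mulC mul1mx mxtrace_scalar.
have -> : \tr ((qb q)^T *m x) = dot (qb q) x by rewrite /mxtrace big_ord1.
have -> : \tr (qb q *m x^T) = dot (qb q) x.
  by rewrite mxtrace_mulC /mxtrace big_ord1 dotC.
rewrite mulr1n; ring.
Qed.

End Quadratics.

(** * Multipliers, the aggregated description and the SDP relaxation *)

Section Aggregation.
Context {R : realType} {N mI mE : nat}.
Variable P : qcqp R N mI mE.
Implicit Types (g : 'cV[R]_(mI + mE)) (t : R) (z : 'cV[R]_N * R^o).

Lemma qhom_sym g t : (t *: qA (obj P) + \sum_i g i 0 *: qA (cstr P i))^T =
  t *: qA (obj P) + \sum_i g i 0 *: qA (cstr P i).
Proof.
rewrite linearD linearZ linear_sum/= qA_sym; congr (_ + _).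
by apply: eq_bigr => i _; rewrite linearZ/= qA_sym.
Qed.

(* t q_0 + sum_i g_i q_i: t = 1 gives q(g, .) and t = 0 gives the paper's breve q(g, .). *)
Definition qhom g t : quadratic R N := {|
  qA := t *: qA (obj P) + \sum_i g i 0 *: qA (cstr P i);
  qb := t *: qb (obj P) + \sum_i g i 0 *: qb (cstr P i);
  qc := t * qc (obj P) + \sum_i g i 0 * qc (cstr P i);
  qA_sym := qhom_sym g t |}.

Lemma Aagg_hom g : Aagg P g = qA (qhom g 1).
Proof. by rewrite /= scale1r. Qed.

Lemma bagg_hom g : bagg P g = qb (qhom g 1).
Proof. by rewrite /= scale1r. Qed.

Lemma qeval_hom g t x : qeval (qhom g t) x = t * qeval (obj P) x + qbreve P g x.
Proof.
rewrite /qbreve !qevalE /= qformD qformZ dotDl dotZl.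
rewrite qform_sum dot_suml.
under [X in _ + X + _ + _]eq_bigr do rewrite qformZ.
under [X in _ + 2 * (_ + X) + _]eq_bigr do rewrite dotZl.
under [in RHS]eq_bigr do rewrite qevalE !mulrDr mulrCA.
by rewrite !big_split/= -mulr_sumr; ring.
Qed.

Lemma qagg_hom g x : qagg P g x = qeval (qhom g 1) x.
Proof. by rewrite qeval_hom mul1r. Qed.

Lemma qbreve_hom g x : qbreve P g x = qeval (qhom g 0) x.
Proof. by rewrite qeval_hom mul0r add0r. Qed.

Lemma qbreve_lin a g g' x : qbreve P (a *: g + g') x = a * qbreve P g x + qbreve P g' x.
Proof.
rewrite /qbreve mulr_sumr -big_split/=; apply: eq_bigr => i _.
by rewrite linear_combination_mxE; ring.
Qed.

Lemma qA_hom_lin a g g' t t' :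
  qA (qhom (a *: g + g') (a * t + t')) = a *: qA (qhom g t) + qA (qhom g' t').
Proof.
rewrite /= scalerDr scaler_sumr scalerA scalerDl addrACA -big_split/=.
congr (_ + _); apply: eq_bigr => i _.
by rewrite linear_combination_mxE scalerDl scalerA.
Qed.

Lemma qb_hom_lin a g g' t t' :
  qb (qhom (a *: g + g') (a * t + t')) = a *: qb (qhom g t) + qb (qhom g' t').
Proof.
rewrite /= scalerDr scaler_sumr scalerA scalerDl addrACA -big_split/=.
congr (_ + _); apply: eq_bigr => i _.
by rewrite linear_combination_mxE scalerDl scalerA.
Qed.

Lemma qhom0 : qA (qhom 0 0) = 0.
Proof. by rewrite /= scale0r big1 ?addr0// => i _; rewrite mxE scale0r. Qed.

(** The homogenisation of [Gamma]: height [t = 1] is [Gamma] itself, and height [t = 0] contains its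
    recession directions once [Gamma] is nonempty. *)
Definition dual_feasible g t :=
  [/\ 0 <= t, psd (qA (qhom g t)) & forall i : 'I_mI, 0 <= g (lshift mE i) 0].

Lemma GammaP g : Gamma P g <-> dual_feasible g 1.
Proof. by rewrite /Gamma /= Aagg_hom; split=> [[? ?]|[_ ? ?]]; split. Qed.

Lemma dual_feasible_lin a g g' t t' : 0 <= a ->
  dual_feasible g t -> dual_feasible g' t' -> dual_feasible (a *: g + g') (a * t + t').
Proof.
move=> a0 [t0 pA g0] [t0' pA' g0']; split.
- by rewrite addr_ge0// mulr_ge0.
- by rewrite qA_hom_lin; apply: psdD => //; exact: psdZ.
- by move=> i; rewrite linear_combination_mxE addr_ge0// mulr_ge0.
Qed.

Lemma dual_feasible0 : dual_feasible 0 0.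
Proof.
split=> // [|i]; last by rewrite mxE.
by rewrite qhom0; exact: psd0.
Qed.

Definition aggregated z := forall g, Gamma P g -> qagg P g z.1 <= 2 * z.2.

(* For t = 0 the direction g is added to gs with arbitrarily large weight. *)
Lemma aggregated_dual z gs : aggregated z -> Gamma P gs ->
  forall g t, dual_feasible g t -> qeval (qhom g t) z.1 <= 2 * t * z.2.
Proof.
move=> hz /GammaP Gs g t fg; have [t0 _ _] := fg.
have [tE|tN0] := eqVneq t 0; last first.
  have t_gt0 : 0 < t by rewrite lt_neqAle eq_sym tN0.
  have Gg : Gamma P (t^-1 *: g).
    have tV : 0 <= t^-1 by rewrite invr_ge0.
    apply/GammaP; have := dual_feasible_lin tV fg dual_feasible0.
    by rewrite !addr0 mulVf.
  have := hz _ Gg; rewrite qagg_hom !qeval_hom.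
  have := qbreve_lin t^-1 g 0 z.1; rewrite addr0 => ->.
  have -> : qbreve P 0 z.1 = 0 by rewrite /qbreve big1// => i _; rewrite mxE mul0r.
  rewrite addr0 mul1r -(ler_pM2l t_gt0) mulrDr mulrA mulfV// mul1r.
  by move/le_trans; apply; rewrite mulrA (mulrC t).
rewrite tE in fg *; rewrite mulr0 mul0r leNgt; apply/negP => pos.
rewrite -qbreve_hom in pos.
(* With the weight [c] the direction contributes exactly [d], more than the slack available at
   [gs]. *)
pose d := `|2 * z.2 - qagg P gs z.1| + 1.
pose c := d / qbreve P g z.1.
have d0 : 0 < d by rewrite ltr_wpDl.
have c0 : 0 <= c by rewrite divr_ge0 ?ltW.
have : Gamma P (c *: g + gs).
  by apply/GammaP; have := dual_feasible_lin c0 fg Gs; rewrite mulr0 add0r.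
move=> /hz; rewrite qagg_hom qeval_hom mul1r qbreve_lin divfK ?gt_eqF//.
have : 2 * z.2 - qagg P gs z.1 < d by rewrite ltr_pwDr// ler_norm.
rewrite qagg_hom qeval_hom mul1r; lra.
Qed.

Lemma frob_agg g z X : X^T = X ->
  let Y := block_mx 1%:M (z.1)^T z.1 X in
  frob (qmx (obj P)) Y + \sum_i g i 0 * frob (qmx (cstr P i)) Y =
  qagg P g z.1 + \tr (Aagg P g *m (X - z.1 *m (z.1)^T)).
Proof.
move=> sX /=; rewrite frob_qmx// /qagg /Aagg mulmxDl mulmx_suml mxtraceD.
rewrite (big_morph (fun M => \tr M) (@mxtraceD _ _) (mxtrace0 _ _)) addrACA -big_split/=.
congr (_ + _); apply: eq_bigr => i _.
by rewrite frob_qmx// mulrDr -scalemxAl mxtraceZ.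
Qed.

Lemma epi_sdp_aggE z X g : X^T = X ->
  let Y : 'M[R]_(1 + N) := block_mx 1%:M (z.1)^T z.1 X in
  [/\ psd Y,
      frob (qmx (obj P)) Y <= 2 * z.2,
      (forall i : 'I_mI, frob (qmx (cstr P (lshift mE i))) Y <= 0)
    & (forall j : 'I_mE, frob (qmx (cstr P (rshift mI j))) Y = 0)] ->
  Gamma P g -> qagg P g z.1 + \tr (Aagg P g *m (X - z.1 *m (z.1)^T)) <= 2 * z.2.
Proof.
move=> sX Y [_ h0 hI hE] [_ g0]; rewrite -frob_agg// -[leRHS]addr0 lerD//.
rewrite big_split_ord/= [X in _ + X]big1 ?addr0 => [|j _]; last first.
  by have /= -> := hE j; rewrite mulr0.
by apply: sumr_le0 => i _; rewrite mulr_ge0_le0//; exact: hI.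
Qed.

Lemma epi_sdp_aggregated z : epi_sdp P z -> aggregated z.
Proof.
move=> [X sX hY] g Gg; have := epi_sdp_aggE sX hY Gg.
have [/(psd_border _ sX) pW _ _ _] := hY; have [pA _] := Gg.
by have := psd_trace_ge0 pA pW; lra.
Qed.

Lemma epi_sub_epi_sdp : epi P `<=` epi_sdp P.
Proof.
move=> z [h0 [hI hE]]; have sX : (z.1 *m (z.1)^T)^T = z.1 *m (z.1)^T.
  by rewrite trmx_mul trmxK.
exists (z.1 *m (z.1)^T) => //=.
have fE q : frob (qmx q) (block_mx 1%:M (z.1)^T z.1 (z.1 *m (z.1)^T)) = qeval q z.1.
  by rewrite frob_qmx// subrr mulmx0 mxtrace0 addr0.
split=> [||i|j]; rewrite ?fE//.
by apply/psd_border => //; rewrite subrr; exact: psd0.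
Qed.

(* Complementary slackness: tightness at a definite multiplier forces X = x x^T. *)
Lemma epi_sdp_definite z g : epi_sdp P z -> Gamma P g -> pd (Aagg P g) ->
  qagg P g z.1 = 2 * z.2 -> epi P z.
Proof.
move=> [X sX hY] Gg pA tight; have := epi_sdp_aggE sX hY Gg.
have [/(psd_border _ sX) pW h0 hI hE] := hY.
rewrite tight gerDl => /(pd_trace_eq0 pA pW)/eqP; rewrite subr_eq0 => /eqP XE.
have fE q : frob (qmx q) (block_mx 1%:M (z.1)^T z.1 X) = qeval q z.1.
  by rewrite frob_qmx// XE subrr mulmx0 mxtrace0 addr0.
by split=> [|]; [rewrite -fE|split=> i; rewrite -fE; [exact: hI|exact: hE]].
Qed.

End Aggregation.

(** * Strong duality for the SDP relaxation *)

Lemma big_option {R : nmodType} {T : finType} (F : option T -> R) :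
  \sum_o F o = F None + \sum_i F (Some i).
Proof.
rewrite (bigD1 None)//= (reindex_omap Some id) /=; last by case.
by congr (_ + _); apply: eq_bigl => i; rewrite eqxx.
Qed.

Section StrongDuality.
Context {R : realType} {N mI mE : nat}.
Variable P : qcqp R N mI mE.

Local Notation p := (N * N + mI.+1)%N.

(** A vector of length [p] stores the entries of the factor [B], followed by the slacks: [ord0] for
    the objective and [lift ord0 k] for inequality [k]. *)
Definition factor_part (u : 'rV[R]_p) : 'M[R]_N := vec_mx (lsubmx u).
Definition slack_part (u : 'rV[R]_p) : 'rV[R]_mI.+1 := rsubmx u.

(* The value of the homogeneous conic constraint system at W = B B^T with squared slacks; the
   index None stands for the objective. *)
Definition conic_map (o : option 'I_(mI + mE)) (u : 'rV[R]_p) : R :=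
  let W := factor_part u *m (factor_part u)^T in
  match o with
  | None => \tr (qA (obj P) *m W) + slack_part u 0 ord0 ^+ 2
  | Some i => \tr (qA (cstr P i) *m W) +
      match fintype.split i with inl k => slack_part u 0 (lift ord0 k) ^+ 2 | inr _ => 0 end
  end.

Lemma continuous_trace_gram (A : 'M[R]_N) :
  continuous (fun u : 'rV[R]_p => \tr (A *m (factor_part u *m (factor_part u)^T))).
Proof.
have -> : (fun u : 'rV[R]_p => \tr (A *m (factor_part u *m (factor_part u)^T))) =
    (fun u => \sum_i \sum_j \sum_k A i j * (u 0 (lshift _ (mxvec_index j k)) *
       u 0 (lshift _ (mxvec_index i k)))).
  apply/funext => u; apply: eq_bigr => i _; rewrite [LHS]mxE; apply: eq_bigr => j _.
  rewrite [X in A i j * X]mxE mulr_sumr; apply: eq_bigr => k _.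
  by rewrite [_^T k i]mxE !mxE.
apply: continuous_bigsum => i; apply: continuous_bigsum => j.
apply: continuous_bigsum => k u.
have c l : continuous (fun u : 'rV[R]_p => u 0 l) by exact: coord_continuous.
exact: (continuousM (@cst_continuous _ _ (A i j) u) (continuousM (c _ u) (c _ u))).
Qed.

Lemma conic_map_continuous o : continuous (conic_map o).
Proof.
have sq j : continuous (fun u : 'rV[R]_p => slack_part u 0 j ^+ 2).
  have c : continuous (fun u : 'rV[R]_p => slack_part u 0 j).
    have -> : (fun u : 'rV[R]_p => slack_part u 0 j) = (fun u => u 0 (rshift _ j)).
      by apply/funext => w; rewrite mxE.
    exact: coord_continuous.
  by move=> u; exact: (continuousM (c u) (c u)).
case: o => [i|] u; last exact: (continuousD (@continuous_trace_gram _ u) (sq _ u)).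
rewrite /conic_map; case: fintype.split => k.
  exact: (continuousD (@continuous_trace_gram _ u) (sq _ u)).
exact: (continuousD (@continuous_trace_gram _ u) (@cst_continuous _ _ 0 u)).
Qed.

Lemma conic_mapZ o (a : R) u : conic_map o (a *: u) = a ^+ 2 * conic_map o u.
Proof.
have fZ : factor_part (a *: u) = a *: factor_part u by rewrite /factor_part !linearZ.
have sZ j : slack_part (a *: u) 0 j = a * slack_part u 0 j by rewrite !mxE.
have tZ A : \tr (A *m (factor_part (a *: u) *m (factor_part (a *: u))^T)) =
    a ^+ 2 * \tr (A *m (factor_part u *m (factor_part u)^T)).
  by rewrite fZ linearZ/= -scalemxAl -!scalemxAr scalerA mxtraceZ expr2.
case: o => [i|] /=; rewrite tZ ?sZ ?exprMn mulrDr//.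
by case: fintype.split => k; rewrite ?sZ ?exprMn ?mulr0.
Qed.

Lemma conic_map_sum (g : option 'I_(mI + mE) -> R) u :
  \sum_o g o * conic_map o u =
  \tr (qA (qhom P (\col_i g (Some i)) (g None)) *m
         (factor_part u *m (factor_part u)^T)) +
  g None * slack_part u 0 ord0 ^+ 2 +
  \sum_k g (Some (lshift mE k)) * slack_part u 0 (lift ord0 k) ^+ 2.
Proof.
set W := factor_part u *m (factor_part u)^T.
rewrite big_option/= -/W mulmxDl mulmx_suml mxtraceD -scalemxAl mxtraceZ.
rewrite (big_morph (fun M => \tr M) (@mxtraceD _ _) (mxtrace0 _ _)).
under [in RHS]eq_bigr do rewrite mxE -scalemxAl mxtraceZ.
have -> : \sum_i g (Some i) * conic_map (Some i) u =
    \sum_i g (Some i) * \tr (qA (cstr P i) *m W) +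
    \sum_k g (Some (lshift mE k)) * slack_part u 0 (lift ord0 k) ^+ 2.
  rewrite /conic_map -/W; under eq_bigr do rewrite mulrDr.
  rewrite big_split/=; congr (_ + _); rewrite big_split_ord/= [X in _ + X]big1 ?addr0.
    by apply: eq_bigr => k _; rewrite (unsplitK (inl k : 'I_mI + 'I_mE)).
  by move=> k _; rewrite (unsplitK (inr k : 'I_mI + 'I_mE)) mulr0.
by rewrite mulrDr; ring.
Qed.

(** A sum of two Gram matrices is positive semidefinite, hence again a Gram matrix, and squared
    slacks add through a square root. *)
Lemma conic_mapD u w : exists z, forall o,
  conic_map o z = conic_map o u + conic_map o w.
Proof.
have [B eB] := psd_gramP (psdD (psd_gram (factor_part u)) (psd_gram (factor_part w))).
pose s : 'rV[R]_mI.+1 := \row_j Num.sqrt (slack_part u 0 j ^+ 2 + slack_part w 0 j ^+ 2).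
exists (row_mx (mxvec B) s) => o.
have fE : factor_part (row_mx (mxvec B) s) = B by rewrite /factor_part row_mxKl mxvecK.
have sE j : slack_part (row_mx (mxvec B) s) 0 j ^+ 2 =
    slack_part u 0 j ^+ 2 + slack_part w 0 j ^+ 2.
  by rewrite /slack_part row_mxKr mxE sqr_sqrtr// addr_ge0// sqr_ge0.
have tE A : \tr (A *m (B *m B^T)) = \tr (A *m (factor_part u *m (factor_part u)^T)) +
    \tr (A *m (factor_part w *m (factor_part w)^T)).
  by rewrite -eB mulmxDr mxtraceD.
case: o => [i|] /=; rewrite fE tE ?sE; last by rewrite addrACA.
by rewrite [RHS]addrACA; congr (_ + _); case: fintype.split => k; rewrite ?sE ?addr0.
Qed.

(** Weighting the zero values by 1 and [gs] gives a definite trace plus nonnegative squares. The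
    trace must vanish, so [W = 0], and each equation then leaves only its squared slack. *)
Lemma conic_map_eq0 gs : Gamma P gs -> pd (Aagg P gs) ->
  forall u, (forall o, conic_map o u = 0) -> u = 0.
Proof.
move=> [_ gs0] pA u h.
pose g o : R := if o is Some i then gs i 0 else 1.
have gE : \col_i g (Some i) = gs by apply/colP => i; rewrite mxE.
have := conic_map_sum g u; rewrite big1 => [|o _]; last by rewrite h mulr0.
rewrite gE [g None]/(1 : R) -Aagg_hom mul1r /= => e.
have W0 : factor_part u *m (factor_part u)^T = 0.
  apply: (pd_trace_eq0 pA (psd_gram _)).
  have := sqr_ge0 (slack_part u 0 ord0).
  have : 0 <= \sum_k gs (lshift mE k) 0 * slack_part u 0 (lift ord0 k) ^+ 2.
    by apply: sumr_ge0 => k _; rewrite mulr_ge0// sqr_ge0.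
  lra.
have s0 j : slack_part u 0 j = 0.
  apply/eqP; rewrite -sqrf_eq0; apply/eqP.
  have [k ->|->] := unliftP ord0 j.
    have := h (Some (lshift mE k)); rewrite /= W0 mulmx0 mxtrace0 add0r.
    by rewrite (unsplitK (inl k : 'I_mI + 'I_mE)).
  by have := h None; rewrite /= W0 mulmx0 mxtrace0 add0r.
have B0 := gram_eq0 W0.
rewrite -[u]hsubmxK -[lsubmx u]vec_mxK -/(factor_part u) B0.
have -> : rsubmx u = 0 by apply/rowP => j; rewrite [LHS]s0 mxE.
by rewrite linear0 row_mx0.
Qed.

(** The duality for quadratic images is applied to the values [y] that [W] and the slacks must
    produce. The functionals nonnegative on the image are dual feasible, and for those
    [aggregated_dual] gives the required sign. *)
Lemma aggregated_epi_sdp gs : Gamma P gs -> pd (Aagg P gs) ->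
  forall z, aggregated P z -> epi_sdp P z.
Proof.
move=> Gs pA z hz; set x := z.1.
pose y o : R := if o is Some i then - qeval (cstr P i) x else 2 * z.2 - qeval (obj P) x.
have [|u hu] := quadratic_image_duality conic_map_continuous conic_mapZ
    (conic_map_eq0 Gs pA) conic_mapD (y := y).
  move=> g hg; pose gc : 'cV[R]_(mI + mE) := \col_i g (Some i).
  have hgB (B : 'M[R]_N) (s : 'rV[R]_mI.+1) : 0 <= \tr (qA (qhom P gc (g None)) *m (B *m B^T)) +
      g None * s 0 ord0 ^+ 2 + \sum_k g (Some (lshift mE k)) * s 0 (lift ord0 k) ^+ 2.
    have := hg (row_mx (mxvec B) s); rewrite conic_map_sum.
    by rewrite /factor_part /slack_part row_mxKl row_mxKr mxvecK.
  (* Each clause comes from a test vector: a unit slack of the objective, a factor of [v v^T], a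
     unit slack of an inequality. *)
  have fg : dual_feasible P gc (g None).
    split.
    - have := hgB 0 (delta_mx 0 ord0).
      rewrite mul0mx mulmx0 mxtrace0 add0r mxE !eqxx expr1n mulr1 big1 ?addr0// => k _.
      by rewrite mxE eqxx eq_sym (negbTE (neq_lift _ _)) expr0n mulr0.
    - split=> [|v]; first exact: qA_sym.
      have [B eB] := psd_gramP (psd_gram v).
      have := hgB B 0; rewrite -eB -qform_trace mxE expr0n mulr0 addr0 big1 ?addr0//.
      by move=> k _; rewrite mxE expr0n mulr0.
    - move=> i; have := hgB 0 (delta_mx 0 (lift ord0 i)).
      rewrite mul0mx mulmx0 mxtrace0 add0r mxE eqxx (negbTE (neq_lift _ _)) expr0n mulr0 add0r.
      rewrite (bigD1 i)//= mxE !eqxx expr1n mulr1 big1 ?addr0 => [|k ki]; first by rewrite mxE.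
      by rewrite mxE eqxx (inj_eq lift_inj) (negbTE ki) expr0n mulr0.
  have := aggregated_dual hz Gs fg; rewrite qeval_hom big_option/=.
  have -> : qbreve P gc z.1 = - \sum_i g (Some i) * - qeval (cstr P i) x.
    by rewrite -sumrN; apply: eq_bigr => i _; rewrite mxE mulrN opprK.
  by rewrite -/x; lra.
set W := factor_part u *m (factor_part u)^T in hu.
pose X := x *m x^T + W.
have sX : X^T = X.
  by rewrite linearD/= !trmx_mul !trmxK.
have XW : X - x *m x^T = W by rewrite /X addrC addKr.
exists X => //=; split=> [||i|j]; rewrite ?frob_qmx// ?XW.
- by apply/psd_border => //; rewrite XW; exact: psd_gram.
- have := hu None; rewrite /= -/W; have := sqr_ge0 (slack_part u 0 ord0); lra.
- have := hu (Some (lshift mE i)); rewrite /= -/W (unsplitK (inl i : 'I_mI + 'I_mE)).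
  have := sqr_ge0 (slack_part u 0 (lift ord0 i)); lra.
- have := hu (Some (rshift mI j)); rewrite /= -/W (unsplitK (inr j : 'I_mI + 'I_mE)).
  lra.
Qed.

End StrongDuality.

(** * Second-order cone representations *)

Section SOC.
Context {R : realType} {N : nat}.

Definition pack_linear {U V : lmodType R} (f : U -> V) (lf : linear f) : {linear U -> V} :=
  HB.pack f (GRing.isLinear.Build R U V *:%R f lf).

Lemma norm2_le {n} (v : 'cV[R]_n) (a : R) : norm2 v <= a <-> 0 <= a /\ dot v v <= a ^+ 2.
Proof.
have -> : dot v v = \sum_i v i 0 ^+ 2 by rewrite dotE; under eq_bigr do rewrite -expr2.
have s0 : 0 <= \sum_i v i 0 ^+ 2 by apply: sumr_ge0 => i _; exact: sqr_ge0.
rewrite /norm2; split=> [h|[a0 h]].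
  have a0 := le_trans (sqrtr_ge0 _) h; split=> //.
  by rewrite -[leLHS]sqr_sqrtr// ler_sqr// nnegrE ?sqrtr_ge0.
by rewrite -[leRHS]ger0_norm// -sqrtr_sqr ler_wsqrtr.
Qed.

Local Notation W := (('cV[R]_N * R^o) * 'cV[R]_0)%type.
Variables (q : quadratic R N) (B : 'M[R]_N) (t : R).

Definition soc_affine (w : W) : R := t * w.1.2 - 2 * dot (qb q) w.1.1.
Definition soc_vector (w : W) : 'cV[R]_(N + 1) :=
  col_mx (2 *: (B^T *m w.1.1)) (soc_affine w)%:M.

Lemma soc_affine_linear : linear (soc_affine : W -> R^o).
Proof.
move=> k u w.
suff e : soc_affine (k *: u + w) = k * soc_affine u + soc_affine w by exact: e.
rewrite /soc_affine.
have -> : (k *: u + w).1.2 = k * (u.1.2 : R) + (w.1.2 : R) :> R by [].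
have -> : (k *: u + w).1.1 = k *: u.1.1 + w.1.1 by [].
by rewrite dotDr dotZr; ring.
Qed.

Lemma soc_vector_linear : linear soc_vector.
Proof.
move=> k u w; rewrite /soc_vector soc_affine_linear scale_col_mx add_col_mx.
have -> : (k *: u + w).1.1 = k *: u.1.1 + w.1.1 by [].
congr col_mx; first by rewrite mulmxDr -scalemxAr scalerDr !scalerA mulrC.
by rewrite raddfD/= -scale_scalar_mx.
Qed.

(* |B^T x|^2 <= l iff |(2 B^T x, l - 1)| <= l + 1. *)
Definition soc_of_quadratic : soc_constraint W :=
  @SocConstraint R W (N + 1) (pack_linear soc_vector_linear)
    (col_mx 0 (- qc q - 1)%:M) (pack_linear soc_affine_linear) (1 - qc q).

Lemma soc_of_quadraticP (x : 'cV[R]_N) (s : R) (u : 'cV[R]_0) : qA q = B *m B^T ->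
  soc_sat soc_of_quadratic ((x, s), u) <-> qeval q x <= t * s.
Proof.
move=> qB; have -> : soc_sat soc_of_quadratic ((x, s), u) <->
    norm2 (soc_vector ((x, s), u) + col_mx 0 (- qc q - 1)%:M) <=
    soc_affine ((x, s), u) + (1 - qc q) by [].
rewrite norm2_le /soc_vector add_col_mx addr0 -raddfD/=.
set l := t * s - 2 * dot (qb q) x - qc q.
have -> : soc_affine ((x, s), u) + (- qc q - 1) = l - 1.
  by rewrite /soc_affine/= /l addrA.
have -> : soc_affine ((x, s), u) + (1 - qc q) = l + 1 by rewrite /soc_affine/= /l addrA addrAC.
have -> : dot (col_mx (2 *: (B^T *m x)) (l - 1)%:M) (col_mx (2 *: (B^T *m x)) (l - 1)%:M) =
    4 * qform (qA q) x + (l - 1) ^+ 2.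
  rewrite {1}/dot tr_col_mx mul_row_col mxE -!/(dot _ _) dotZl dotZr qB qformE -mulmxA.
  rewrite [dot x _]dot_mulmx; congr (_ + _); first by ring.
  by rewrite dotE big_ord1 !mxE eqxx mulr1n expr2.
have q0 : 0 <= qform (qA q) x by rewrite qB; exact: (psd_gram B).2.
have lE : qeval q x <= t * s <-> qform (qA q) x <= l.
  by rewrite qevalE /l; split; lra.
by rewrite lE; split=> [[]|h]; [lra|split; [lra|lra]].
Qed.

End SOC.

Lemma soc_representable_quadratics {R : realType} {N : nat} {I : finType}
    (q : I -> quadratic R N) (t : I -> R) : (forall i, psd (qA (q i))) ->
  soc_representable [set z : 'cV[R]_N * R^o | forall i, qeval (q i) z.1 <= t i * z.2].
Proof.
move=> pq; have /choice[B qB] := fun i => psd_gramP (pq i).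
exists 0%N, #|I|, (fun j => soc_of_quadratic (q (enum_val j)) (B (enum_val j)) (t (enum_val j))).
apply/seteqP; split=> [[x s] /= h|[x s] /= [u h] i].
  by exists 0 => j; apply/soc_of_quadraticP.
by have /soc_of_quadraticP := h (enum_rank i); rewrite enum_rankK; exact.
Qed.

(** * Semidefinite faces *)

Section Directions.
Context {R : realType}.

(** A largest free family in [S] spans [S], since a vector of [S] outside the span would extend
    it. *)
Lemma lin_dim_basis {V : vectType R} (S : set V) :
  exists X : (lin_dim S).-tuple V,
    [/\ free X, forall x, x \in X -> S x & forall x, S x -> x \in <<X>>%VS].
Proof.
pose Q (d : 'I_(\dim {:V}).+1) :=
  `[< exists2 X : d.-tuple V, free X & forall x, x \in X -> S x >].
have [|d dQ dE] := @eq_bigmax_cond _ Q (@nat_of_ord _).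
  apply/card_gt0P; exists ord0; apply/asboolP; exists [tuple] => //.
  by rewrite /free span_nil dimv0.
have -> : lin_dim S = d by [].
have /asboolP[X fX XS] := dQ; exists X; split=> // x Sx; apply: contraT => xX.
have fxX : free (x :: X) by rewrite free_cons xX.
(* The maximum defining [lin_dim] is over a bounded range, so the extended family must be shown to
   fit in it. *)
have dV : (d.+1 < (\dim {:V}).+1)%N.
  rewrite ltnS -(size_tuple X) -[X in (X <= _)%N]/(size (x :: X)) -(eqnP fxX).
  exact/dimvS/subvf.
have := @leq_bigmax_cond _ Q (@nat_of_ord _) (Ordinal dV); rewrite dE /= ltnn; apply.
apply/asboolP; exists [tuple of x :: X] => // y.
by rewrite inE => /orP[/eqP ->//|]; exact: XS.
Qed.

(** Orthogonality to a spanning family of the differences amounts to [lin_dim D] linear equations on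
    the [d] coefficients over [X]. As [lin_dim D < d], there is a nonzero solution, and freeness of
    [X] keeps [v] nonzero. *)
Lemma aff_dim_orthogonal {N d : nat} (T : set 'cV[R]_N) (X : d.-tuple 'cV[R]_N) :
  T !=set0 -> free X -> aff_dim T + 1 <= d%:Z ->
  exists v, [/\ v != 0, v \in <<X>>%VS & forall y y', T y -> T y' -> dot (y - y') v = 0].
Proof.
move=> T0 fX; rewrite /aff_dim; case: asboolP => // _.
set D := [set x - y | x in T & y in T] => dd.
have {}dd : (lin_dim D < d)%N by rewrite -addn1 -lez_nat.
have [Y [_ _ YD]] := lin_dim_basis D.
pose K : 'M[R]_(d, lin_dim D) := \matrix_(i, j) dot (tnth Y j) (tnth X i).
have kerK : kermx K != 0.
  rewrite -mxrank_eq0 mxrank_ker subn_eq0 -ltnNge.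
  exact: leq_ltn_trans (rank_leq_col K) dd.
have c0 : nz_row (kermx K) != 0 by rewrite nz_row_eq0.
set c := nz_row (kermx K) in c0.
have cK : c *m K = 0 by apply/sub_kermxP; exact: nz_row_sub.
pose v := \sum_i c 0 i *: tnth X i.
have vE : v = \sum_(i < d) c 0 i *: X`_i.
  by apply: eq_bigr => i _; rewrite (tnth_nth 0).
exists v; split.
- apply: contraNneq c0 => v0; apply/eqP/rowP => i; rewrite mxE.
  by have /freeP := fX; apply; rewrite -vE.
- rewrite memv_suml// => i _; apply: memvZ; apply: memv_span; exact: mem_tnth.
- move=> y y' Ty Ty'; have /YD/coord_span -> : D (y - y') by exists y => //; exists y'.
  rewrite dot_suml big1// => j _; rewrite dotZl -tnth_nth /v dotC dot_suml.
  have /matrixP/(_ 0 j) := cK; rewrite !mxE => e.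
  suff -> : \sum_i dot (c 0 i *: tnth X i) (tnth Y j) = 0 by rewrite mulr0.
  by rewrite -[RHS]e; apply: eq_bigr => i _; rewrite dotZl mxE dotC.
Qed.

Context {N mI mE : nat} (P : qcqp R N mI mE).

Lemma VF_span {d} (X : d.-tuple 'cV[R]_N) F v :
  (forall x, x \in X -> VF P F x) -> v \in <<X>>%VS -> VF P F v.
Proof.
move=> XF /coord_span -> g Fg; rewrite mulmx_sumr big1// => i _.
by rewrite -scalemxAr XF ?scaler0//; apply: mem_nth; rewrite size_tuple.
Qed.

(* A multiplier of maximal rank in F, for which the kernel of A(g) is already V(F). *)
Lemma VF_max_rank (F : set 'cV[R]_(mI + mE)) : F !=set0 -> F `<=` Gamma P -> convex_set F ->
  exists2 g, F g & forall v, Aagg P g *m v = 0 -> VF P F v.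
Proof.
move=> [g0 Fg0] FG /convex_setP cF.
pose Q n := `[< exists2 g, F g & \rank (Aagg P g) = n >].
have [||n /asboolP[g Fg <-] gmax] := @ex_maxnP Q N.
- by exists (\rank (Aagg P g0)); apply/asboolP; exists g0.
- by move=> n /asboolP[g _ <-]; exact: rank_leq_row.
exists g => // v gv g' Fg'.
have h0 : 0 <= 2^-1 :> R by rewrite invr_ge0.
have h1 : 2^-1 <= 1 :> R by rewrite invf_le1// ler1n.
(* At the midpoint [h] the kernel is the intersection of the kernels at [g] and [g']. Its row space
   thus contains that of [g]; by maximality of the rank they coincide, so the kernel at [g] lies in
   the kernel at [g']. *)
have Fh := cF _ _ _ Fg Fg' h0 h1; set h := _ + _ in Fh.
have hA w : qform (Aagg P h) w =
    2^-1 * qform (Aagg P g) w + (1 - 2^-1) * qform (Aagg P g') w.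
  have := qA_hom_lin P 2^-1 g ((1 - 2^-1) *: g') 1 (1 - 2^-1).
  rewrite mulr1 addrCA subrr addr0 -!Aagg_hom -/h => ->.
  have := qA_hom_lin P (1 - 2^-1) g' 0 1 0.
  by rewrite !addr0 mulr1 qhom0 addr0 -Aagg_hom => ->; rewrite qformD !qformZ.
have ker (w : 'cV[R]_N) : Aagg P h *m w = 0 -> Aagg P g *m w = 0 /\ Aagg P g' *m w = 0.
  move=> hw; have := hA w; rewrite {1}qformE hw dot0r.
  have [pg _] := FG _ Fg; have [pg' _] := FG _ Fg'.
  have := pg.2 w; have := pg'.2 w; rewrite -!/(qform _ _) => w0' w0 e.
  by split; apply: psd_ker => //; lra.
have gh : (Aagg P g <= Aagg P h)%MS.
  rewrite submxE; apply/eqP/matrixP => i j.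
  have /ker[/colP/(_ i) + _] : Aagg P h *m col j (cokermx (Aagg P h)) = 0.
    by rewrite colE mulmxA mulmx_coker mul0mx.
  by rewrite colE mulmxA -colE [col _ _ _ _]mxE => ->; rewrite !mxE.
have hg : (Aagg P h <= Aagg P g)%MS.
  rewrite -(mxrank_leqif_sup gh) eqn_leq (mxrankS gh) gmax//.
  by apply/asboolP; exists h.
have [D hD] := submxP hg.
by have [] := ker v; rewrite // hD -mulmxA gv mulmx0.
Qed.

End Directions.

(** * Kernels of matrices with Kronecker structure *)

Section Kronecker.
Context {R : realType} {N : nat}.

Lemma kron_factor_lin k a (M M' : 'M[R]_N) : (0 < N)%N ->
  kron_factor k M -> kron_factor k M' -> kron_factor k (a *: M + M').
Proof.
move=> N0 [n [e [B [sB ->]]]] [n' [e' [B' [sB' ->]]]].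
have k0 : (0 < k)%N by case: (k) e N0 => // <-.
have nn : n' = n by apply/eqP; rewrite -(eqn_pmul2l k0) e e'.
subst n'; rewrite (eq_irrelevance e' e) {e'}.
exists n, e, (a *: B + B'); split; first by rewrite linearP/= sB sB'.
subst N; rewrite !castmx_id; apply/matrixP => i j.
case: (mxtens_indexP i) => i1 i2; case: (mxtens_indexP j) => j1 j2.
by rewrite linear_combination_mxE !tensmxE linear_combination_mxE; ring.
Qed.

(** A singular [1%:M *t B] has singular [B]. A kernel vector [w] of [B] then yields the [k]
    independent kernel vectors [delta_mx i 0 *t w]. *)
Lemma kron_factor_kernel k (M : 'M[R]_N) (v : 'cV[R]_N) : kron_factor k M -> v != 0 -> M *m v = 0 ->
  exists2 X : k.-tuple 'cV[R]_N, free X & forall x, x \in X -> M *m x = 0.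
Proof.
move=> [n [e [B [sB ->]]]] v0; subst N; rewrite castmx_id => Mv.
have /andP[k0 n0] : (k != 0%N) && (n != 0%N).
  rewrite -!lt0n -muln_gt0 lt0n; apply: contraNN v0 => /eqP kn0.
  by apply/eqP/colP => i; have := ltn_ord i; rewrite {2}kn0.
have Bu : B \notin unitmx.
  apply: contraNN v0 => Bu; have : (1%:M : 'M[R]_k) *t B \in unitmx.
    by apply: tensmx_unit; rewrite ?unitmx1.
  by move=> u; rewrite -(mulKmx u v) Mv mulmx0.
have [w w0 Bw] : exists2 w : 'cV[R]_n, w != 0 & B *m w = 0.
  have : kermx B != 0 by rewrite kermx_eq0 row_free_unit.
  rewrite -nz_row_eq0 => h; exists (nz_row (kermx B))^T; first by rewrite trmx_eq0.
  by rewrite -{1}sB -trmx_mul (sub_kermxP (nz_row_sub _)) trmx0.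
pose f (i : 'I_k) : 'cV[R]_(k * n) := (delta_mx i 0 : 'cV[R]_k) *t w.
have tE (u : 'cV[R]_k) i1 i2 :
    (u *t w : 'cV[R]_(k * n)) (mxtens_index (i1, i2)) (mxtens_index ((0 : 'I_1), (0 : 'I_1))) =
    u i1 0 * w i2 0 by exact: tensmxE.
exists [tuple f i | i < k].
  have nthf (i : 'I_k) : [tuple f i | i < k]`_i = f i by rewrite -tnth_nth tnth_mktuple.
  apply/freeP => c; have -> : \sum_(i < k) c i *: [tuple f i | i < k]`_i =
      (\col_i c i : 'cV[R]_k) *t w.
    under eq_bigr do rewrite nthf.
    apply/matrixP => i j; have -> : j = mxtens_index ((0 : 'I_1), (0 : 'I_1)).
      exact: etrans (ord1 j) (esym (ord1 _)).
    case: (mxtens_indexP i) => i1 i2.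
    rewrite tE summxE (bigD1 i1)//= big1 ?addr0 => [|i' ii'].
      rewrite [LHS]mxE /f tE !mxE !eqxx.
      by rewrite mul1r.
    rewrite [LHS]mxE /f tE !mxE.
    by rewrite eq_sym (negbTE ii')/= mul0r mulr0.
  move=> e i; have [j wj] : exists j, w j 0 != 0.
    apply/existsP; apply: contraNT w0; rewrite negb_exists => /forallP h.
    by apply/eqP/colP => j; rewrite mxE; apply/eqP; rewrite -[_ == _]negbK.
  have /matrixP/(_ (mxtens_index (i, j)) (mxtens_index ((0 : 'I_1), (0 : 'I_1)))) := e.
  rewrite tE !mxE => /eqP; rewrite mulf_eq0 (negbTE wj) orbF.
  by move/eqP.
move=> x /mapP[i _ ->]; rewrite /f.
have /= -> := tensmx_mul (1%:M : 'M[R]_k) B (delta_mx i 0 : 'cV[R]_k) w.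
by rewrite Bw tensmx0.
Qed.

End Kronecker.

Section SemidefiniteFace.
Context {R : realType} {N mI mE : nat} (P : qcqp R N mI mE).

Lemma kron_factor_Aagg k g : (0 < N)%N -> kron_factor k (qA (obj P)) ->
  (forall i, kron_factor k (qA (cstr P i))) -> kron_factor k (Aagg P g).
Proof.
move=> N0 h0 hc; rewrite /Aagg addrC.
(* Carrying [qA (obj P)] along settles the empty sum; when two sums are added, the copy counted
   twice is subtracted. *)
apply: (big_ind (fun M => kron_factor k (M + qA (obj P)))) => [|A B hA hB|i _].
- by rewrite add0r.
- have := kron_factor_lin (-1) N0 h0 (kron_factor_lin 1 N0 hA hB).
  rewrite scale1r scaleN1r; congr kron_factor.
  by rewrite addrACA [LHS]addrC [X in X - _]addrA addrK.
- exact: (kron_factor_lin _ N0 (hc i) h0).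
Qed.

(** At a multiplier of maximal rank a trivial kernel would make the semidefinite matrix definite,
    and with it the face. *)
Lemma semidefinite_kernel F : semidefinite_face P F -> F !=set0 ->
  exists2 g, F g & (exists2 v : 'cV[R]_N, v != 0 & Aagg P g *m v = 0) /\
    (forall v, Aagg P g *m v = 0 -> VF P F v).
Proof.
move=> [[FG cF _] ndef] F0; have [g Fg hg] := VF_max_rank F0 FG cF.
exists g => //; split=> //; apply: contrapT => nov; apply: ndef; exists g => //.
have [pA _] := FG _ Fg; split=> [|v v0]; first exact: pA.1.
rewrite -/(qform (Aagg P g) v) lt_neqAle (pA.2 v : 0 <= qform _ _) andbT.
by apply/eqP => q0; apply: nov; exists v => //; apply: psd_ker.
Qed.

Lemma qem_free_tuple F : (0 < N)%N -> semidefinite_face P F -> F !=set0 -> (0 < qem P)%N ->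
  exists2 X : (qem P).-tuple 'cV[R]_N, free X & forall x, x \in X -> VF P F x.
Proof.
move=> N0 sF F0 q0; pose Q (k : 'I_N.+1) := `[< kron_factor k (qA (obj P)) /\
   forall i, kron_factor k (qA (cstr P i)) >].
(* Over an empty range the maximum defaults to 0, so a positive [qem P] is attained. *)
have Q_gt0 : (0 < #|Q|)%N.
  rewrite lt0n; apply: contraTneq q0 => /card0_eq Q0.
  by rewrite /qem big_pred0// => k; exact: (Q0 k).
have [k /asboolP[h0 hc] kE] := @eq_bigmax_cond _ Q (@nat_of_ord _) Q_gt0.
have {}kE : qem P = k by exact: kE.
have [g Fg [[v v0 gv] hg]] := semidefinite_kernel sF F0.
have [X fX XA] := kron_factor_kernel (kron_factor_Aagg g N0 h0 hc) v0 gv.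
by rewrite kE; exists X => // x /XA /hg.
Qed.

(* The common content of hypotheses (i) and (ii). *)
Definition face_direction F := exists v s,
  [/\ v != 0, VF P F v & forall g, F g -> dot (bagg P g) v = s].

Lemma face_direction_free F d (X : d.-tuple 'cV[R]_N) : F !=set0 -> free X ->
  (forall x, x \in X -> VF P F x) -> aff_dim [set bagg P g | g in F] + 1 <= d%:Z ->
  face_direction F.
Proof.
move=> [g0 Fg0] fX XF dX.
have [|v [v0 vX orth]] := aff_dim_orthogonal _ fX dX.
  by exists (bagg P g0); exists g0.
exists v, (dot (bagg P g0) v); split=> [//||g Fg]; first exact: VF_span XF vX.
apply/eqP; rewrite -subr_eq0 -mulN1r -dotZl scaleN1r -dotDl; apply/eqP/orth.
  by exists g.
by exists g0.
Qed.

Lemma face_direction_lin_dim F : F !=set0 ->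
  aff_dim [set bagg P g | g in F] + 1 <= (lin_dim (VF P F))%:Z -> face_direction F.
Proof.
move=> F0; have [X [fX XF _]] := lin_dim_basis (VF P F).
exact: (face_direction_free F0 fX XF).
Qed.

Lemma face_direction_qem F : (0 < N)%N -> semidefinite_face P F -> F !=set0 ->
  aff_dim [set bagg P g | g in F] + 1 <= (qem P)%:Z -> face_direction F.
Proof.
move=> N0 sF F0 h.
(* A nonempty set has affine dimension at least 0, so the bound makes [qem P] positive. *)
have q0 : (0 < qem P)%N.
  rewrite -ltz_nat; apply: lt_le_trans h; rewrite /aff_dim.
  rewrite asboolT ?ltzD1//.
  by have [g Fg] := F0; exists (bagg P g); exists g.
have [X fX XF] := qem_free_tuple N0 sF F0 q0.
exact: (face_direction_free F0 fX XF h).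
Qed.

End SemidefiniteFace.

(** * The convex hull of the epigraph *)

Section FirstExit.
Context {R : realType} {I : finType}.

(* a -> p + b a - k a^2 vanishes at 2 p / (sqrt (b^2 + 4 k p) - b), which also covers k = 0. *)
Lemma concave_first_exit (Q : pred I) (p b k : I -> R) :
  (forall i, Q i -> 0 < p i) -> (forall i, Q i -> 0 <= k i) ->
  (exists2 i, Q i & 0 < k i) ->
  exists a, [/\ 0 < a, forall i, Q i -> 0 <= p i + b i * a - k i * a ^+ 2 &
    exists2 i, Q i & p i + b i * a - k i * a ^+ 2 = 0].
Proof.
move=> p0 k0 [i0 Qi0 ki0].
pose s i := Num.sqrt (b i ^+ 2 + 4 * k i * p i).
pose r i := 2 * p i / (s i - b i).
have disc0 i : Q i -> 0 <= b i ^+ 2 + 4 * k i * p i.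
  by move=> Qi; rewrite addr_ge0 ?sqr_ge0// !mulr_ge0// ?k0// ltW// p0.
have s2 i : Q i -> s i ^+ 2 = b i ^+ 2 + 4 * k i * p i.
  by move=> Qi; rewrite sqr_sqrtr// disc0.
have s0 i : 0 <= s i by exact: sqrtr_ge0.
(* Positive curvature at [i0] guarantees a positive root; the smallest root over all [i] with
   [b i < s i] is the exit point. *)
have sb0 : b i0 < s i0.
  rewrite ltNge; apply/negP => h.
  have := s2 _ Qi0; have := p0 _ Qi0; have := s0 i0 => h1 h2 h3.
  have := mulr_gt0 ki0 h2; nra.
have [i /andP[Qi sbi] rmin] := @arg_minP _ _ _ i0 (fun i => Q i && (b i < s i)) r
  (introT andP (conj Qi0 sb0)).
have r_gt0 j : Q j -> b j < s j -> 0 < r j.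
  by move=> Qj sbj; rewrite divr_gt0 ?subr_gt0// mulr_gt0// p0.
have rroot j : Q j -> b j < s j -> p j + b j * r j - k j * r j ^+ 2 = 0.
  move=> Qj sbj; have sbN : s j - b j != 0 by rewrite gt_eqF// subr_gt0.
  have -> : p j + b j * r j - k j * r j ^+ 2 =
      p j * (s j ^+ 2 - (b j ^+ 2 + 4 * k j * p j)) / (s j - b j) ^+ 2.
    by rewrite /r; field.
  by rewrite s2// subrr mulr0 mul0r.
exists (r i); split; [exact: r_gt0| |by exists i => //; exact: rroot].
move=> j Qj; have ri0 := r_gt0 _ Qi sbi; have pj := p0 _ Qj; have kj := k0 _ Qj.
have [sbj|sbj] := ltP (b j) (s j).
  have rj0 := r_gt0 _ Qj sbj; have e := rroot _ Qj sbj.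
  have rij : r i <= r j by apply: rmin; rewrite Qj sbj.
  have h1 : 0 <= p j * (r j - r i) by rewrite mulr_ge0 ?subr_ge0// ltW.
  have d0 : 0 <= r j - r i by rewrite subr_ge0.
  have h2 := mulr_ge0 (mulr_ge0 (mulr_ge0 kj (ltW ri0)) (ltW rj0)) d0.
  (* After multiplication by [r j], the value at [r i] is a multiple of the zero value at [r j] plus
     two terms that are nonnegative because [r i <= r j]. *)
  rewrite -(pmulr_lge0 _ rj0).
  have -> : (p j + b j * r i - k j * r i ^+ 2) * r j =
      r i * (p j + b j * r j - k j * r j ^+ 2) + p j * (r j - r i) + k j * r i * r j * (r j - r i).
    ring.
  by rewrite e mulr0 add0r addr_ge0.
(* No root to reach here: [s j <= b j] forces [k j = 0] and [0 <= b j]. *)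
have bj0 : 0 <= b j by exact: le_trans (s0 j) sbj.
have kj0 : k j = 0.
  have h1 : s j ^+ 2 <= b j ^+ 2 by rewrite ler_sqr ?nnegrE.
  have := s2 _ Qj.
  move=> h2; have h3 : k j * p j <= 0 by lra.
  by apply/eqP; rewrite eq_le kj andbT -(pmulr_lle0 (k j) pj) h3.
rewrite kj0 mul0r subr0 addr_ge0//; first exact: ltW.
by rewrite mulr_ge0// ltW.
Qed.

End FirstExit.

Lemma ge0_of_affine {R : realType} (a b : R) : (forall c, 0 <= c -> 0 <= a + c * b) -> 0 <= b.
Proof.
move=> h; rewrite leNgt; apply/negP => b0.
have c0 : 0 <= (`|a| + 1) / - b by rewrite divr_ge0 ?addr_ge0// oppr_ge0 ltW.
have := h _ c0; have -> : (`|a| + 1) / - b * b = - (`|a| + 1) by field; rewrite lt_eqF.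
by have := ler_norm a; lra.
Qed.

(** Every condition at [gs + c *: f] is affine in [c] and holds for all [c >= 0], so its slope is
    nonnegative. *)
Lemma recession_dual_feasible {R : realType} {N mI mE : nat} (P : qcqp R N mI mE) gs f :
  Gamma P gs -> recession (Gamma P) f -> dual_feasible P f 0.
Proof.
move=> Gs rf; have G c : 0 <= c -> dual_feasible P (c *: f + gs) (c * 0 + 1).
  by move=> c0; rewrite mulr0 add0r addrC; apply/GammaP; exact: rf.
split=> // [|k]; last first.
  apply: (ge0_of_affine (a := gs (lshift mE k) 0)) => c c0.
  by have [_ _ /(_ k)] := G _ c0; rewrite linear_combination_mxE addrC.
split=> [|v]; first exact: qA_sym.
rewrite -/(qform _ _); apply: (ge0_of_affine (a := qform (qA (qhom P gs 1)) v)) => c c0.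
have [_ [_ /(_ v) + ] _] := G _ c0.
by rewrite -/(qform _ _) qA_hom_lin qformD qformZ addrC.
Qed.

(** * Tight generators and the convex hull of the epigraph *)

Section Generators.
Context {R : realType} {N mI mE : nat} (P : qcqp R N mI mE).
Context {I : finType} (g : I -> 'cV[R]_(mI + mE)) (t : I -> R).
Hypothesis t_ge0 : forall i, 0 <= t i.
Hypothesis g_Gamma : forall i, 0 < t i -> Gamma P ((t i)^-1 *: g i).
Hypothesis Gamma_gen : Gamma P = [set x | exists c : I -> R,
  [/\ forall i, 0 <= c i, \sum_i c i * t i = 1 & x = \sum_i c i *: g i]].
Hypothesis g_recession : forall i, t i = 0 -> recession (Gamma P) (g i).
Context (gs : 'cV[R]_(mI + mE)) (Gs : Gamma P gs) (pA : pd (Aagg P gs)).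

Local Notation q i := (qhom P (g i) (t i)).

Lemma dual_feasible_gen i : dual_feasible P (g i) (t i).
Proof.
have [ti|tiN0] := eqVneq (t i) 0; last first.
  have ti : 0 < t i by rewrite lt_neqAle eq_sym tiN0 t_ge0.
  have /GammaP G1 := g_Gamma ti.
  have := dual_feasible_lin (t_ge0 i) G1 (dual_feasible0 P).
  by rewrite !addr0 mulr1 scalerA mulfV// scale1r.
by rewrite ti; apply: recession_dual_feasible Gs _; exact: g_recession.
Qed.

Lemma psd_gen i : psd (qA (q i)).
Proof. by have [] := dual_feasible_gen i. Qed.

Lemma qA_hom_sum (c : I -> R) :
  qA (qhom P (\sum_i c i *: g i) (\sum_i c i * t i)) = \sum_i c i *: qA (q i).
Proof.
elim/big_ind3 : _ => [|x1 x2 x3 y1 y2 y3 e1 e2|i _]; first exact: qhom0.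
  by have := qA_hom_lin P 1 x3 y3 x2 y2; rewrite !scale1r mul1r e1 e2.
have := qA_hom_lin P (c i) (g i) 0 (t i) 0.
by rewrite !addr0 qhom0 addr0.
Qed.

Lemma qeval_hom_sum (c : I -> R) x :
  qeval (qhom P (\sum_i c i *: g i) (\sum_i c i * t i)) x = \sum_i c i * qeval (q i) x.
Proof.
under [RHS]eq_bigr do rewrite qeval_hom mulrDr mulrA.
rewrite qeval_hom big_split/= mulr_suml; congr (_ + _).
rewrite /qbreve; under [RHS]eq_bigr do rewrite mulr_sumr.
rewrite exchange_big/=; apply: eq_bigr => j _; rewrite summxE mulr_suml.
by apply: eq_bigr => i _; rewrite mxE mulrA.
Qed.

Lemma aggregated_gen z :
  aggregated P z <-> forall i, qeval (q i) z.1 <= 2 * t i * z.2.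
Proof.
split=> [hz i|hz x]; first exact: (aggregated_dual hz Gs (dual_feasible_gen i)).
rewrite Gamma_gen => -[c [c0 c1 ->]]; rewrite qagg_hom -[X in qhom _ _ X]c1 qeval_hom_sum.
have -> : 2 * z.2 = \sum_i c i * (2 * t i * z.2) :> R.
  under eq_bigr do rewrite mulrA (mulrCA _ 2) -mulrA.
  by rewrite -mulr_sumr -mulr_suml c1 mul1r.
by apply: ler_sum => i _; exact: ler_wpM2l.
Qed.

Definition slack z i : R := 2 * t i * z.2 - qeval (q i) z.1.

Definition tight_face z : set 'cV[R]_(mI + mE) :=
  [set x | Gamma P x /\ qagg P x z.1 = 2 * z.2].

Lemma qagg_combine (l : R) x y w :
  qagg P (l *: x + (1 - l) *: y) w = l * qagg P x w + (1 - l) * qagg P y w.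
Proof.
rewrite !qagg_hom !qeval_hom qbreve_lin.
have -> : qbreve P ((1 - l) *: y) w = (1 - l) * qbreve P y w.
  by rewrite /qbreve mulr_sumr; apply: eq_bigr => i _; rewrite mxE mulrA.
ring.
Qed.

(** For fixed [z] the aggregate is affine in the multiplier and bounded by [2 * z.2], so a proper
    convex combination attains the bound only if both ends do. *)
Lemma tight_face_is_face z : aggregated P z -> is_face (Gamma P) (tight_face z).
Proof.
move=> hz; have cG x y l : Gamma P x -> Gamma P y -> 0 <= l -> l <= 1 ->
    Gamma P (l *: x + (1 - l) *: y).
  move=> /GammaP Gx /GammaP Gy l0 l1; apply/GammaP.
  have l1' : 0 <= 1 - l by rewrite subr_ge0.
  have := dual_feasible_lin l0 Gx (dual_feasible_lin l1' Gy (dual_feasible0 P)).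
  by rewrite !addr0 !mulr1 addrCA subrr addr0.
split=> [x []//||x y l Gx Gy l0 l1 [_ e]].
  apply/convex_setP => x y l [Gx ex] [Gy ey] l0 l1; split; first exact: cG.
  by rewrite qagg_combine ex ey; ring.
have hx := hz _ Gx; have hy := hz _ Gy; rewrite qagg_combine in e.
by split; split=> //; nra.
Qed.

Lemma tight_face_gen z i : 0 < t i -> slack z i = 0 -> tight_face z ((t i)^-1 *: g i).
Proof.
move=> ti; rewrite /slack qeval_hom => e; split; first exact: g_Gamma.
rewrite qagg_hom qeval_hom mul1r.
have -> : qbreve P ((t i)^-1 *: g i) z.1 = (t i)^-1 * qbreve P (g i) z.1.
  by rewrite /qbreve mulr_sumr; apply: eq_bigr => j _; rewrite mxE mulrA.
have -> : qbreve P (g i) z.1 = t i * (2 * z.2 - qeval (obj P) z.1) by lra.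
by field; rewrite gt_eqF.
Qed.

Lemma tight_face_recession z x i : t i = 0 -> slack z i = 0 -> tight_face z x ->
  tight_face z (x + g i).
Proof.
move=> ti; rewrite /slack qeval_hom ti mulr0 !mul0r sub0r add0r => /eqP.
rewrite oppr_eq0 => /eqP e [Gx ex]; split.
  by have := g_recession ti Gx ler01; rewrite scale1r.
have := qbreve_lin P 1 x (g i) z.1.
by rewrite scale1r mul1r e addr0 -ex !qagg_hom !qeval_hom => ->.
Qed.

Lemma slack_line z i v s a : slack (z + a *: ((v, s) : 'cV[R]_N * R^o)) i =
  slack z i + 2 * (t i * s - dot z.1 (qA (q i) *m v) - dot (qb (q i)) v) * a
    - qform (qA (q i)) v * a ^+ 2.
Proof.
rewrite /slack.
have -> : (z + a *: ((v, s) : 'cV[R]_N * R^o)).1 = z.1 + a *: v by [].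
have -> : (z + a *: ((v, s) : 'cV[R]_N * R^o)).2 = (z.2 : R) + a * s :> R by [].
rewrite qeval_line; ring.
Qed.

(** Conditions on the face pass to the tight generators: one with [t i > 0] is a multiple of a point
    of the face, and one with [t i = 0] is the difference of two such points. The generator [i0]
    supplies the base point. *)
Lemma tight_direction z v s i0 : 0 < t i0 -> slack z i0 = 0 ->
  VF P (tight_face z) v -> (forall x, tight_face z x -> dot (bagg P x) v = s) ->
  forall i, slack z i = 0 -> qA (q i) *m v = 0 /\ dot (qb (q i)) v = t i * s.
Proof.
move=> ti0 zi0 Vv Vs i zi.
have F0 := tight_face_gen ti0 zi0; set x0 := _ *: _ in F0.
have [ti|tiN0] := eqVneq (t i) 0.
  have F1 := tight_face_recession ti zi F0.
  have eA := qA_hom_lin P 1 (g i) x0 (t i) 1; have eb := qb_hom_lin P 1 (g i) x0 (t i) 1.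
  rewrite !scale1r mul1r ti add0r [g i + x0]addrC -!Aagg_hom in eA.
  rewrite !scale1r mul1r ti add0r [g i + x0]addrC -!bagg_hom in eb.
  rewrite ti mul0r; split.
    by have := Vv _ F1; rewrite eA mulmxDl (Vv _ F0) addr0.
  by have := Vs _ F1; rewrite eb dotDl (Vs _ F0) => h; lra.
have ti : 0 < t i by rewrite lt_neqAle eq_sym tiN0 t_ge0.
have F1 := tight_face_gen ti zi.
have eA := qA_hom_lin P (t i) ((t i)^-1 *: g i) 0 1 0.
have eb := qb_hom_lin P (t i) ((t i)^-1 *: g i) 0 1 0.
have qb0 : qb (qhom P 0 0) = 0.
  by rewrite /= scale0r add0r big1// => j _; rewrite mxE scale0r.
rewrite !addr0 mulr1 scalerA mulfV// scale1r qhom0 addr0 -Aagg_hom in eA.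
rewrite !addr0 mulr1 scalerA mulfV// scale1r qb0 addr0 -bagg_hom in eb.
by rewrite eA eb -scalemxAl (Vv _ F1) scaler0 dotZl (Vs _ F1).
Qed.

Lemma tight_line_exit z v s : v != 0 -> aggregated P z ->
  (forall i, slack z i = 0 -> qA (q i) *m v = 0 /\ dot (qb (q i)) v = t i * s) ->
  exists a, [/\ 0 < a, aggregated P (z + a *: ((v, s) : 'cV[R]_N * R^o)),
    forall i, slack z i = 0 -> slack (z + a *: ((v, s) : 'cV[R]_N * R^o)) i = 0 &
    exists2 i, slack z i != 0 & slack (z + a *: ((v, s) : 'cV[R]_N * R^o)) i = 0].
Proof.
move=> v0 /aggregated_gen hz hv.
have slack0 i : 0 <= slack z i by rewrite subr_ge0.
have tight a i : slack z i = 0 -> slack (z + a *: ((v, s) : 'cV[R]_N * R^o)) i = 0.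
  move=> zi; have [Av bv] := hv _ zi.
  by rewrite slack_line zi qformE Av !dot0r bv; ring.
have psdq i : 0 <= qform (qA (q i)) v by exact: (psd_gen i).2.
have [|||a [a0 ha [i Qi ei]]] := @concave_first_exit _ _ (fun i => slack z i != 0)
  (slack z) (fun i => 2 * (t i * s - dot z.1 (qA (q i) *m v) - dot (qb (q i)) v))
  (fun i => qform (qA (q i)) v).
- by move=> i zi; rewrite lt_neqAle eq_sym zi slack0.
- by move=> i _; exact: psdq.
(* The definite [gs] is a nonnegative combination of generators, so one of them is curved along [v].
   It is not tight, because tight generators annihilate [v]. *)
- move: (Gs) (pA.2 _ v0); rewrite Gamma_gen => -[c [c0 c1 gsE]].
  rewrite -/(qform _ _) Aagg_hom gsE -[X in qhom _ _ X]c1 qA_hom_sum qform_sum => pos.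
  apply: contrapT => /forall2NP h; move: pos; rewrite big1 ?ltxx// => i _.
  rewrite qformZ (_ : qform _ _ = 0) ?mulr0//; apply/eqP; rewrite eq_le psdq andbT leNgt.
  apply/negP => ki; have [zi|zi] := eqVneq (slack z i) 0.
    by move: ki; rewrite qformE (hv _ zi).1 dot0r ltxx.
  by case: (h i).
exists a; split=> //.
- apply/aggregated_gen => j; rewrite -subr_ge0 -/(slack _ j).
  have [zj|zj] := eqVneq (slack z j) 0; first by rewrite tight.
  by rewrite slack_line; exact: ha.
- by move=> j; exact: tight.
- by exists i => //; rewrite slack_line.
Qed.

Hypothesis face_directions : forall F, semidefinite_face P F -> F !=set0 -> face_direction P F.

(** Induction on the number of generators that are not tight: leaving [z] along [(v, s)] in either
    direction keeps the tight ones and adds another. *)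
Lemma conv_hull_epi_tight z : aggregated P z -> (exists2 i, 0 < t i & slack z i = 0) ->
  conv_hull (epi P) z.
Proof.
have [n] := ubnP #|[pred i | slack z i != 0]|; elim: n z => // n IHn z zn hz [i0 ti0 zi0].
have F0 : tight_face z !=set0 by exists ((t i0)^-1 *: g i0); exact: tight_face_gen.
have [[x [Gx tx] px]|ndef] := pselect (definite P (tight_face z)).
  apply: sub_conv_hull; apply: epi_sdp_definite Gx px tx.
  exact: aggregated_epi_sdp Gs pA _ hz.
have [v [s [v0 Vv Vs]]] := face_directions (conj (tight_face_is_face hz) ndef) F0.
have dir := tight_direction ti0 zi0 Vv Vs.
have half w r : w != 0 ->
    (forall i, slack z i = 0 -> qA (q i) *m w = 0 /\ dot (qb (q i)) w = t i * r) ->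
    exists2 a : R, 0 < a & conv_hull (epi P) (z + a *: ((w, r) : 'cV[R]_N * R^o)).
  move=> w0 hw; have [a [a0 ha tight [j zj ej]]] := tight_line_exit w0 hz hw.
  exists a => //; apply: IHn => //; last by exists i0 => //; exact: tight.
  rewrite -ltnS; apply: leq_trans zn; rewrite ltnS; apply: proper_card.
  apply/properP; split; last by exists j; rewrite !inE ?ej ?eqxx.
  by apply/fintype.subsetP => i; rewrite !inE; apply: contraNN => /eqP/tight ->.
have [a a0 ha] := half v s v0 dir.
have [|i zi|b b0 hb] := half (- v) (- s); first by rewrite oppr_eq0.
  by have [Av bv] := dir _ zi; rewrite mulmxN Av oppr0 -scaleN1r dotZr bv; split=> //; ring.
have ab0 : 0 < a + b by rewrite addr_gt0.
(* Weights inversely proportional to the two step lengths make the displacements cancel. *)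
have cE : z = (b / (a + b)) *: (z + a *: ((v, s) : 'cV[R]_N * R^o)) +
    (1 - b / (a + b)) *: (z + b *: ((- v, - s) : 'cV[R]_N * R^o)).
  have -> : (- v, - s) = - ((v, s) : 'cV[R]_N * R^o) by [].
  rewrite !scalerDr !scalerN !scalerA addrACA -scalerDl -scalerBl.
  have -> : b / (a + b) + (1 - b / (a + b)) = 1 by ring.
  have -> : b / (a + b) * a - (1 - b / (a + b)) * b = 0 by field; rewrite gt_eqF.
  by rewrite scale1r scale0r addr0.
have /convex_setP cc := @conv_hull_convex _ _ (epi P).
rewrite cE; apply: cc => //; first by rewrite divr_ge0// ltW.
by rewrite ler_pdivrMr// mul1r lerDr ltW.
Qed.

(** The epigraph is closed under raising its last coordinate, and the points whose raised copy lies
    in the hull form a convex set. *)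
Lemma conv_hull_epi_up (z : 'cV[R]_N * R^o) (d : R) : 0 <= d -> conv_hull (epi P) z ->
  conv_hull (epi P) (z + (0, d)).
Proof.
move=> d0; apply: (@conv_hull_sub _ _ _ [set z | conv_hull (epi P) (z + (0, d))]).
  apply/convex_setP => x y l hx hy l0 l1 /=.
  have /convex_setP cc := @conv_hull_convex _ _ (epi P).
  have -> : l *: x + (1 - l) *: y + (0, d) =
      l *: (x + (0, d)) + (1 - l) *: (y + (0, d)); last exact: cc.
  rewrite !scalerDr addrACA -scalerDl; congr (_ + _).
  by rewrite addrCA subrr addr0 scale1r.
move=> x [hx fx]; apply: sub_conv_hull; split=> /=; last by rewrite addr0.
by rewrite addr0 mulrDr ler_wpDr// mulr_ge0.
Qed.

Lemma conv_hull_epi_aggregated : conv_hull (epi P) = aggregated P.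
Proof.
apply/seteqP; split=> [|z hz].
  apply: conv_hull_sub => [|z /epi_sub_epi_sdp/epi_sdp_aggregated//].
  apply/convex_setP => x y l hx hy l0 l1 h Gh.
  have [pAh _] := Gh; rewrite Aagg_hom in pAh.
  have := qeval_convex x.1 y.1 pAh l0 l1; rewrite -!qagg_hom => /le_trans; apply.
  have -> : 2 * (l *: x + (1 - l) *: y).2 = l * (2 * x.2) + (1 - l) * (2 * y.2) :> R.
    have -> : (l *: x + (1 - l) *: y).2 = l * (x.2 : R) + (1 - l) * (y.2 : R) :> R by [].
    ring.
  by rewrite lerD// ler_wpM2l ?subr_ge0//; [exact: hx|exact: hy].
have [i0 ti0] : exists i, 0 < t i.
  apply: contrapT => /forallNP h; move: (Gs); rewrite Gamma_gen => -[c [_ + _]].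
  rewrite big1 => [/eqP|i _]; first by rewrite eq_sym oner_eq0.
  by rewrite (_ : t i = 0) ?mulr0//; apply/eqP; rewrite eq_le t_ge0 andbT leNgt; apply/negP.
(* [f i] is the least last coordinate that generator [i] permits. Lowering [z] to the largest of
   these keeps it aggregated and makes a generator with [t i > 0] tight; [conv_hull_epi_up] then
   restores the original coordinate. *)
pose f i := qeval (q i) z.1 / (2 * t i).
have [i ti fmax] := @arg_maxP _ _ _ i0 (fun i => 0 < t i) f ti0.
have le_f j : 0 < t j -> (qeval (q j) z.1 <= 2 * t j * f i).
  move=> tj; rewrite -ler_pdivrMl ?mulr_gt0// mulrC; exact: fmax.
have hz' : aggregated P (z.1, f i).
  apply/aggregated_gen => j /=; have [tj|tjN0] := eqVneq (t j) 0.
    have /aggregated_gen/(_ j) := hz; by rewrite tj !(mulr0, mul0r).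
  by apply: le_f; rewrite lt_neqAle eq_sym tjN0 t_ge0.
have fz : f i <= z.2.
  rewrite ler_pdivrMr ?mulr_gt0// mulrC.
  by have /aggregated_gen := hz; exact.
have -> : z = (z.1, f i : R^o) + (0, z.2 - f i : R^o).
  by rewrite [LHS]surjective_pairing; congr pair; rewrite ?addr0//= addrC subrK.
apply: conv_hull_epi_up; first by rewrite subr_ge0.
apply: conv_hull_epi_tight => //; exists i => //.
by rewrite /slack /= /f mulrC divfK ?subrr// mulf_neq0// gt_eqF.
Qed.

End Generators.

(** * The description by an arbitrary Minkowski-Weyl decomposition *)

Section Decomposition.
Context {R : realType} {N mI mE : nat} (P : qcqp R N mI mE).
Context (gs : 'cV[R]_(mI + mE)) (Gs : Gamma P gs).

Lemma qeval_convex_function (q : quadratic R N) : psd (qA q) ->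
  convex_function [set: 'cV[R]_N] (qeval q).
Proof. by move=> pA t x y _ _; apply: qeval_convex. Qed.

Context (Ge Gr : set 'cV[R]_(mI + mE)) (MW : MW_decomposition P Ge Gr).

Lemma MW_sub_Gamma : Ge `<=` Gamma P.
Proof.
have [_ _ ->] := MW; move=> e he; exists e => //; exists 0; last by rewrite addr0.
by have [] := conic_hull_cone Gr.
Qed.

Lemma MW_sub_recession : Gr `<=` recession (Gamma P).
Proof.
have [_ _ GE] := MW; move=> f hf x c; rewrite GE => -[e he [f' hf' <-]] c0.
exists e => //; exists (f' + c *: f); last by rewrite addrA.
have [_ CD CZ] := conic_hull_cone Gr; apply: CD => //; apply: CZ => //.
exact: sub_conic_hull.
Qed.

(** Each inequality is affine in its multiplier: it extends from the extreme points to the polytope,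
    and for directions further to the conic hull. *)
Lemma aggregated_MW z : aggregated P z <->
  (forall ge, extr Ge ge -> qagg P ge z.1 <= 2 * z.2) /\
  (forall gf, extr Gr gf -> qbreve P gf z.1 <= 0).
Proof.
split=> [hz|[he hf] x].
  split=> [e [/MW_sub_Gamma Ge_e _]|f [/MW_sub_recession rf _]]; first exact: hz.
  have := aggregated_dual hz Gs (recession_dual_feasible Gs rf).
  by rewrite mulr0 mul0r -qbreve_hom.
have [pGe pGr ->] := MW; move=> -[e Ge_e [f Gr_f <-]].
have {}he : qagg P e z.1 <= 2 * z.2.
  apply: (polytope_sub_convex (C := [set e | qagg P e z.1 <= 2 * z.2])) Ge_e => //.
  apply/convex_setP => x1 x2 l h1 h2 l0 l1 /=; rewrite qagg_combine.
  have l1' : 0 <= 1 - l by rewrite subr_ge0.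
  have := ler_wpM2l l0 h1; have := ler_wpM2l l1' h2; lra.
have cone0 : convex_cone [set f | qbreve P f z.1 <= 0].
  split=> [|f1 f2 h1 h2|a f1 a0 h1] /=.
  - by rewrite /qbreve big1// => i _; rewrite mxE mul0r.
  - by have := qbreve_lin P 1 f1 f2 z.1; rewrite scale1r mul1r => ->; move: h1 h2 => /=; lra.
  - rewrite /qbreve; under eq_bigr do rewrite mxE -mulrA.
    by rewrite -mulr_sumr mulr_ge0_le0.
have {}hf : qbreve P f z.1 <= 0.
  apply: (conic_hull_sub cone0) Gr_f.
  by apply: polytope_sub_convex => //; exact: convex_cone_convex.
have := qbreve_lin P 1 e f z.1; rewrite scale1r mul1r qagg_hom qeval_hom => ->.
by move: he; rewrite qagg_hom qeval_hom; lra.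
Qed.

End Decomposition.

Theorem mainTheorem3 (R : realType) (N mI mE : nat)
    (hN : (1 <= N)%N) (hm : (1 <= mI + mE)%N)
    (P : qcqp R N mI mE)
    (hfeas : feasible P !=set0)
    (hdual : exists2 gs : 'cV[R]_(mI + mE),
        (forall i : 'I_mI, 0 <= gs (lshift mE i) 0) & pd (Aagg P gs))
    (hpoly : polyhedral (Gamma P)) :
  [/\ exists Ge Gr : set 'cV[R]_(mI + mE), MW_decomposition P Ge Gr,
      forall Ge Gr : set 'cV[R]_(mI + mE), MW_decomposition P Ge Gr ->
        [/\ epi_sdp P =
              [set z | (forall ge, extr Ge ge -> qagg P ge z.1 <= 2 * z.2) /\
                       (forall gf, extr Gr gf -> qbreve P gf z.1 <= 0)],
            finite_set (extr Ge),
            finite_set (extr Gr),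
            forall ge, extr Ge ge ->
              convex_function [set: 'cV[R]_N] (qagg P ge)
          & forall gf, extr Gr gf ->
              convex_function [set: 'cV[R]_N] (qbreve P gf)],
      soc_representable (epi_sdp P)
    & (forall F, semidefinite_face P F ->
         aff_dim [set bagg P g | g in F] + 1 <= (lin_dim (VF P F))%:Z) \/
      (forall F, semidefinite_face P F ->
         aff_dim [set bagg P g | g in F] + 1 <= (qem P)%:Z) ->
      soc_representable (conv_hull (epi P))].
Proof.
have [gs gs0 pA] := hdual.
have Gs : Gamma P gs by split; [exact: pd_psd|].
have sdpE : epi_sdp P = aggregated P.
  by apply/seteqP; split=> z; [exact: epi_sdp_aggregated|exact: aggregated_epi_sdp Gs pA _].
have [I [g [t [t0 g_Gamma Gamma_gen g_rec]]]] := polyhedral_generators hpoly.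
have soc : soc_representable (epi_sdp P).
  rewrite sdpE.
  have -> : aggregated P = [set z | forall i, qeval (qhom P (g i) (t i)) z.1 <= 2 * t i * z.2].
    by apply/seteqP; split=> z /(aggregated_gen t0 g_Gamma Gamma_gen g_rec Gs).
  apply: soc_representable_quadratics => i.
  exact: (psd_gen t0 g_Gamma g_rec Gs).
split=> //.
- exact: polyhedral_minkowski_weyl hpoly.
- move=> Ge Gr MW; have [pGe pGr _] := MW; split.
  + by rewrite sdpE; apply/seteqP; split=> z /(aggregated_MW Gs MW).
  + exact: polytope_finite_extr.
  + exact: polytope_finite_extr.
  + move=> e [/(MW_sub_Gamma MW)[pe _] _]; rewrite Aagg_hom in pe.
    have -> : qagg P e = qeval (qhom P e 1) by apply/funext => x; rewrite qagg_hom.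
    exact: qeval_convex_function.
  + move=> f [/(MW_sub_recession MW)/(recession_dual_feasible Gs)[_ pf _] _].
    have -> : qbreve P f = qeval (qhom P f 0) by apply/funext => x; rewrite qbreve_hom.
    exact: qeval_convex_function.
(* Under either condition the hull equals the aggregated set, which is the projected relaxation
   already represented. *)
- move=> hF; rewrite (conv_hull_epi_aggregated t0 g_Gamma Gamma_gen g_rec Gs pA) -?sdpE//.
  move=> F sF F0; case: hF => hF; first exact: face_direction_lin_dim F0 (hF F sF).
  exact: face_direction_qem hN sF F0 (hF F sF).
Qed.
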